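(* Let $\Delta\geq 4$ be an integer and let $G$ be an outerplanar graph with maximum degree $\Delta(G)\leq\Delta$. Then $G$ has a conditional incidence $\Delta$-coloring.
   Context: All graphs are simple. An outerplanar graph is a graph that can be embedded in the plane with all vertices on the outer face. For a graph $G$, an incidence is a pair $(v,e)$ with $v$ an endpoint of the edge $e$; $I(G)$ is the set of incidences. For $u\in V(G)$ and a neighbor $v$, $(u,uv)$ is a strong incidence of $u$ and $(v,uv)$ is a weak incidence of $u$; $I_u$, $A_u$ denote the sets of strong, resp. weak, incidences of $u$. Let $[\Delta]=\{1,\dots,\Delta\}$. A conditional incidence $\Delta$-coloring of $G$ is a map $\varphi: I(G)\to[\Delta]$ such that: (a) $(u,uv)$ and $(v,uv)$ receive distinct colors for each edge $uv$; (b) each color appears at most once among $A_u$ for each vertex $u$; (c) each color appears at most once among $I_u$ for each vertex $u$; (d) each color of $[\Delta]$ appears at least once among $A_u\cup I_u$ for each vertex $u$ with $\deg_G(u)\geq\Delta-1$. *)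

(* Defs.v *)
From HB Require Import structures.
From mathcomp Require Import all_boot all_order all_algebra.
From mathcomp Require Import all_classical all_reals all_analysis.

Set Implicit Arguments.
Unset Strict Implicit.
Unset Printing Implicit Defensive.

Import Order.TTheory GRing.Theory Num.Theory.
Import numFieldNormedType.Exports.

Local Open Scope classical_set_scope.
Local Open Scope ring_scope.

Record sgraph := SGraph {
  svertex :> finType;
  adj : rel svertex;
  adj_sym : symmetric adj;
  adj_irr : irreflexive adj }.

Section Graph.
Variable G : sgraph.

Definition edges : {set {set G}} :=
  [set [set p.1; p.2]%SET | p : G * G & adj p.1 p.2]%SET.

Definition degree (u : G) : nat := #|[set v | adj u v]%SET|.

Definition max_degree : nat := (\max_(u : G) degree u)%N.

Definition incidence : finType :=
  {i : G * {set G} | (i.2 \in edges) && (i.1 \in i.2)}.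

Definition strong (u : G) : {set incidence} :=
  [set i | [exists v, adj u v && (val i == (u, [set u; v]%SET))]]%SET.

Definition weak (u : G) : {set incidence} :=
  [set i | [exists v, adj u v && (val i == (v, [set u; v]%SET))]]%SET.

Definition conditional_incidence_coloring (Delta : nat)
    (phi : incidence -> 'I_Delta) : Prop :=
  [/\ forall (u v : G) (i j : incidence), adj u v ->
        val i = (u, [set u; v]%SET) -> val j = (v, [set u; v]%SET) ->
        phi i <> phi j,
      forall (u : G) (c : 'I_Delta),
        (#|[set i in weak u | phi i == c]%SET| <= 1)%N,
      forall (u : G) (c : 'I_Delta),
        (#|[set i in strong u | phi i == c]%SET| <= 1)%N &
      forall u : G, (Delta - 1 <= degree u)%N -> forall c : 'I_Delta,
        exists2 i, i \in (weak u :|: strong u)%SET & phi i = c].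

(* An edge e is drawn as the simple arc arc e, parametrized by [0, 1]; the
   values of arc e outside [0, 1], and of arc off the edge set, are junk. *)
Definition plane_embedding (R : realType) (pos : G -> R * R)
    (arc : {set G} -> R -> R * R) : Prop :=
  [/\ injective pos,
      forall e, e \in edges ->
        {within `[0, 1], continuous (arc e)} /\
        {in `[0, 1] &, injective (arc e)},
      forall e, e \in edges ->
        [set arc e 0; arc e 1] = [set pos u | u in [set u | u \in e]],
      forall e, e \in edges -> forall (w : G) (t : R), t \in `]0, 1[ ->
        arc e t <> pos w &
      forall e f, e \in edges -> f \in edges -> e <> f ->
        forall s t : R, s \in `]0, 1[ -> t \in `]0, 1[ -> arc e s <> arc f t].

Definition drawing (R : realType) (pos : G -> R * R)
    (arc : {set G} -> R -> R * R) : set (R * R) :=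
  range pos `|` \bigcup_(e in [set e | e \in edges]) (arc e @` `[0, 1]).

(* The drawing of a finite graph is compact, so exactly one component of its
   complement is unbounded. *)
Definition outer_face (R : realType) (D : set (R * R)) : set (R * R) :=
  [set p | (~` D) p /\ ~ bounded_set (connected_component (~` D) p)].

(* A vertex is on a face when it is on the boundary of that open set, i.e. in
   its closure, since vertices are not in the complement of the drawing. *)
Definition outerplanar (R : realType) : Prop :=
  exists (pos : G -> R * R) (arc : {set G} -> R -> R * R),
    plane_embedding pos arc /\
    forall v : G, closure (outer_face (drawing pos arc)) (pos v).

End Graph.

(* Main.v *)
Require Import Defs.
From HB Require Import structures.
From mathcomp Require Import all_classical all_reals all_analysis.
From mathcomp Require Import all_boot all_order all_algebra.
From mathcomp Require Import zify ssrAC ring lra.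

(** The argument passes through a combinatorial shadow of outerplanarity.
Replace the arcs by close polygonal lines and join every vertex [v] to a far point
by a polygonal line that avoids the drawing except near v.  Two disjoint
segments are vertically ordered in the same way at both ends of their common
range; summed mod 2 along the polygonal lines, this shows that the vertices
carry a tournament (a not necessarily transitive "order") for which the ends of
two disjoint edges interleave an even number of times.  This excludes K_4 and
K_{2,3}: a lobe that is minimal among the subgraphs attached at a single vertex
has a Hamiltonian cycle with noncrossing chords.  Looking at a shortest chord
that spans at least three edges of this cycle, one finds a vertex of degree 1,
two adjacent vertices of degree 2, a triangle with vertices of degrees 2 and 3,
or two or three consecutive triangles cut off by chords.  Each of these
configurations can be removed, colored inductively and put back, where
condition (d) leaves the necessary freedom; for the chains of triangles the last
step is a finite search. *)

Set Implicit Arguments.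
Unset Strict Implicit.
Unset Printing Implicit Defensive.

Local Open Scope nat_scope.

(** * Even tournaments *)

(* The parity of the interleaving of the pairs {a, b} and {c, d}, when [t u v]
   reads "u comes before v"; [t] need not be transitive. *)
Definition interleave (V : eqType) (t : rel V) (a b c d : V) : bool :=
  t a c (+) t a d (+) (t b c (+) t b d).

Definition even_tournament (V : finType) (e t : rel V) : Prop :=
  (forall u v, u != v -> t u v = ~~ t v u) /\
  (forall a b c d, e a b -> e c d -> [disjoint [:: a; b] & [:: c; d]] ->
    interleave t a b c d = false).

Lemma uniq_cat_disjoint (T : finType) (s1 s2 : seq T) :
  uniq (s1 ++ s2) -> [disjoint s1 & s2].
Proof. by rewrite cat_uniq has_sym disjoint_has => /and3P[]. Qed.

Section EvenTournament.
Variables (V : finType) (e t : rel V).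
Hypothesis even_t : even_tournament e t.
Implicit Types (a b c d p q x y : V) (r s : seq V).

Lemma interleave_addl a b c x y :
  interleave t a c x y = interleave t a b x y (+) interleave t b c x y.
Proof. by rewrite /interleave; do 6!case: (t _ _). Qed.

Lemma interleave_addr a b x y z :
  interleave t a b x z = interleave t a b x y (+) interleave t a b y z.
Proof. by rewrite /interleave; do 6!case: (t _ _). Qed.

Lemma interleave_paths a r c s : path e a r -> path e c s ->
  [disjoint a :: r & c :: s] -> interleave t a (last a r) c (last c s) = false.
Proof.
have edge_path a' b' c' s' : e a' b' -> path e c' s' ->
    [disjoint [:: a'; b'] & c' :: s'] ->
    interleave t a' b' c' (last c' s') = false.
  move=> ab; elim: s' c' => [|d s' IH] c' /=; first by rewrite /interleave !addbb.
  move=> /andP[cd ds]; rewrite disjoint_sym disjoint_cons => /andP[c_ab dis].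
  have d_ab : d \notin [:: a'; b'] by move: dis; rewrite disjoint_cons => /andP[].
  rewrite (interleave_addr _ _ _ d) IH 1?disjoint_sym // addbF.
  by apply: even_t.2; rewrite // disjoint_sym !disjoint_cons c_ab d_ab disjoint0.
elim: r a => [|b r IH] a /=; first by rewrite /interleave addbb.
move=> /andP[ab br] cs; rewrite disjoint_cons => /andP[a_cs dis].
have b_cs : b \notin c :: s by move: dis; rewrite disjoint_cons => /andP[].
rewrite (interleave_addl _ b) IH // addbF.
by apply: edge_path; rewrite // !disjoint_cons a_cs b_cs disjoint0.
Qed.

Lemma odd_interleave_pairings a b c d : uniq [:: a; b; c; d] ->
  interleave t a b c d (+) interleave t b c d a (+) interleave t a c b d.
Proof.
rewrite /= !inE !negb_or andbT => /and3P[/and3P[ab ac ad] /andP[bc bd] cd].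
rewrite /interleave (even_t.1 c b) 1?eq_sym // (even_t.1 b a) 1?eq_sym //.
rewrite (even_t.1 c a) 1?eq_sym //.
by do 6!case: (t _ _).
Qed.

Lemma interleave_cycle a b c d r1 r2 r3 r4 :
  let s := a :: r1 ++ b :: r2 ++ c :: r3 ++ d :: r4 in
  uniq s -> cycle e s -> interleave t a b c d = false.
Proof.
move=> s uniq_s; rewrite /s /= !(rcons_cat, rcons_cons).
rewrite -!cat_rcons !cat_path !last_rcons => /and4P[path_ab _ path_cd _].
have sub_s : subseq ((a :: rcons r1 b) ++ c :: rcons r3 d) s.
  rewrite /s -(cat_rcons b) -cat_cons; apply: cat_subseq => //.
  apply: subseq_trans (suffix_subseq r2 _).
  by rewrite -cat_rcons -cat_cons prefix_subseq.
have := interleave_paths path_ab path_cd; rewrite !last_rcons; apply.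
exact/uniq_cat_disjoint/(subseq_uniq sub_s).
Qed.

Lemma no_crossing_chords a b c d r1 r2 r3 r4 s :
  s = a :: r1 ++ b :: r2 ++ c :: r3 ++ d :: r4 ->
  uniq s -> cycle e s -> e a c -> e b d -> False.
Proof.
move=> -> {s} uniq_s cycle_s ac bd; set s := a :: _ in uniq_s cycle_s.
have uniq_abcd : uniq [:: a; b; c; d].
  have sub_cons x (s1 s2 s3 : seq V) : subseq s1 s3 -> subseq (x :: s1) (s2 ++ x :: s3).
    by move=> s13; apply: subseq_trans (suffix_subseq s2 _); rewrite /= eqxx.
  exact/(subseq_uniq _ uniq_s)/(sub_cons _ _ [::])/sub_cons/sub_cons/sub_cons/sub0seq.
have rot_s : rot (size (a :: r1)) s = b :: r2 ++ c :: r3 ++ d :: r4 ++ a :: r1.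
  by rewrite /s -cat_cons rot_size_cat /= -!catA /= -!catA.
have := odd_interleave_pairings uniq_abcd.
rewrite (interleave_cycle uniq_s cycle_s).
rewrite (@interleave_cycle b c d a r2 r3 r4 r1) -?rot_s ?rot_uniq ?rot_cycle //.
rewrite even_t.2 //; apply: uniq_cat_disjoint; move: uniq_abcd.
by rewrite /= !inE !negb_or (eq_sym c b); do !case: (_ == _).
Qed.

Lemma cycle_no_crossing_chords x0 s i j k l : uniq s -> cycle e s ->
  i < j -> j < k -> k < l -> l < size s ->
  e (nth x0 s i) (nth x0 s k) -> e (nth x0 s j) (nth x0 s l) -> False.
Proof.
move=> s_uniq s_cycle ij jk kl ls.
have split_drop (m m' : nat) : m < m' -> m' < size s ->
    exists r, drop m.+1 s = r ++ nth x0 s m' :: drop m'.+1 s.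
  move=> mm' m's; exists (take (m' - m.+1) (drop m.+1 s)).
  by rewrite -[LHS](cat_take_drop (m' - m.+1)) drop_drop subnK // -drop_nth.
have ks := ltn_trans kl ls; have js := ltn_trans jk ks; have i_lt := ltn_trans ij js.
have [r1 r1E] := split_drop i j ij js; have [r2 r2E] := split_drop j k jk ks.
have [r3 r3E] := split_drop k l kl ls.
have rot_s : rot i s = nth x0 s i :: r1 ++ nth x0 s j :: r2 ++ nth x0 s k ::
    r3 ++ nth x0 s l :: (drop l.+1 s ++ take i s).
  by rewrite /rot (drop_nth x0) // r1E r2E r3E /= -!catA /= -!catA /= -!catA.
by apply: no_crossing_chords rot_s _ _; rewrite ?rot_uniq ?rot_cycle.
Qed.

Lemma disjoint_paths_neq p q x y r1 r2 :
  path e p (rcons (x :: r1) q) -> path e p (rcons (y :: r2) q) ->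
  uniq (p :: q :: (x :: r1) ++ y :: r2) -> t p x (+) t x q != t p y (+) t y q.
Proof.
have even u v s1 s2 : path e p (rcons (u :: s1) q) -> path e p (rcons (v :: s2) q) ->
    uniq (p :: q :: (u :: s1) ++ v :: s2) -> interleave t p u v q = false.
  move=> /andP[pu _] /andP[_ vq] uniq_uv.
  have := @interleave_paths p [:: u] v (rcons s2 q); rewrite last_rcons /= pu.
  apply=> //; apply/uniq_cat_disjoint.
  rewrite -[_ ++ _]/(p :: rcons [:: u, v & s2] q) cons_uniq mem_rcons rcons_uniq -2!cons_uniq.
  by apply: subseq_uniq uniq_uv; rewrite /= !eqxx suffix_subseq.
move=> path_x path_y uniq_xy.
have uniq_yx : uniq (p :: q :: (y :: r2) ++ x :: r1).
  by rewrite (perm_uniq (s2 := p :: q :: (x :: r1) ++ y :: r2)) // !perm_cons perm_catC.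
have xy : x != y.
  by apply: contraTneq uniq_xy => ->; rewrite /= mem_cat mem_head orbT !andbF.
have := even _ _ _ _ path_y path_x uniq_yx; have := even _ _ _ _ path_x path_y uniq_xy.
by rewrite /interleave (even_t.1 y x) 1?eq_sym //; do 6!case: (t _ _).
Qed.

Lemma no_theta p q r1 r2 r3 : r1 != [::] -> r2 != [::] -> r3 != [::] ->
  path e p (rcons r1 q) -> path e p (rcons r2 q) -> path e p (rcons r3 q) ->
  ~~ uniq (p :: q :: r1 ++ r2 ++ r3).
Proof.
case: r1 r2 r3 => [|x r1] [|y r2] [|z r3] // _ _ _ path1 path2 path3; apply/negP => uniq_s.
have uniq12 : uniq (p :: q :: (x :: r1) ++ y :: r2).
  by apply: subseq_uniq uniq_s; rewrite /= !eqxx cat_subseq // -cat_cons prefix_subseq.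
have uniq13 : uniq (p :: q :: (x :: r1) ++ z :: r3).
  by apply: subseq_uniq uniq_s; rewrite /= !eqxx cat_subseq // -cat_cons suffix_subseq.
have uniq23 : uniq (p :: q :: (y :: r2) ++ z :: r3).
  exact/(subseq_uniq _ uniq_s)/(cat_subseq (subseq_refl [:: p; q]))/suffix_subseq.
(* A boolean cannot take three pairwise distinct values. *)
have := disjoint_paths_neq path1 path2 uniq12; have := disjoint_paths_neq path1 path3 uniq13.
have := disjoint_paths_neq path2 path3 uniq23.
by case: (_ (+) _); case: (_ (+) _); case: (_ (+) _).
Qed.

End EvenTournament.

Definition deg (V : finType) (e : rel V) u := #|[set v | e u v]|.

Lemma leq_deg (V : finType) (e e' : rel V) u : subrel e e' -> deg e u <= deg e' u.
Proof.
by move=> e_e'; apply/subset_leq_card/subsetP => v; rewrite !inE; exact: e_e'.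
Qed.

Section Lobes.
Variables (V : finType) (e t : rel V).
Hypotheses (e_sym : symmetric e) (e_irr : irreflexive e).
Hypothesis even_t : even_tournament e t.
Implicit Types (u v w x y z p q : V) (A B : {set V}) (r s : seq V).

Definition induced A : rel V := [rel u v | [&& e u v, u \in A & v \in A]].

Lemma connect_induced_sym A : connect_sym (induced A).
Proof.
by apply: sym_connect_sym => u v; rewrite /induced /= e_sym (andbC (u \in A)).
Qed.

Lemma connect_induced_path A y z : y \in A -> connect (induced A) y z ->
  exists r, [/\ path e y r, last y r = z, uniq (y :: r) & {subset y :: r <= A}].
Proof.
move=> yA /connectP[r0 r0_path ->]; case/shortenP: r0_path => r r_path r_uniq _.
exists r; split=> // [|u]; first by apply: sub_path r_path => u v /and3P[].
rewrite inE => /orP[/eqP->//|]; elim: r y r_path {yA r_uniq} => //= v r IH y.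
by move=> /andP[/and3P[_ _ vA] /IH r_sub]; rewrite inE => /orP[/eqP->|].
Qed.

Lemma path_rev_rcons x y r : path e x (rcons r y) -> path e y (rcons (rev r) x).
Proof.
rewrite -(eq_path (e := fun u v => e v u)) // -rev_path belast_rcons last_rcons.
by rewrite rev_cons.
Qed.

(* A part of the graph that is attached to the rest at [c] only. *)
Definition lobe B c := [&& c \in B, B != [set c] & [forall u in B :\ c,
  (0 < deg e u) && [forall w, e u w ==> (w \in B)]]].

Lemma lobe_closed B c u w : lobe B c -> u \in B :\ c -> e u w -> w \in B.
Proof. by move=> /and3P[_ _ /forall_inP B_lobe] /B_lobe/andP[_ /forallP/(_ w)/implyP]. Qed.

Lemma lobe_deg_gt0 B c u : lobe B c -> u \in B :\ c -> 0 < deg e u.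
Proof. by move=> /and3P[_ _ /forall_inP B_lobe] /B_lobe/andP[]. Qed.

Lemma lobe_nonisolated u : 0 < deg e u -> lobe [set v | 0 < deg e v] u.
Proof.
have deg_gt0 v w : e v w -> 0 < deg e w.
  by move=> vw; apply/card_gt0P; exists v; rewrite inE e_sym.
move=> du; apply/and3P; split; first by rewrite inE.
  have [w] := card_gt0P du; rewrite inE => uw; apply/negP => /eqP/setP/(_ w).
  by rewrite !inE (deg_gt0 u w uw) => /esym/eqP wu; rewrite wu e_irr in uw.
apply/forall_inP => v; rewrite !inE => /andP[_ dv]; rewrite dv /=.
by apply/forallP => w; apply/implyP => /deg_gt0; rewrite inE.
Qed.

Section MinimalLobe.
Variables (B : {set V}) (c : V).
Hypothesis lobeB : lobe B c.
Hypothesis minB : forall B' c', lobe B' c' -> #|B| <= #|B'|.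
Hypothesis deg_neq1 : forall u, deg e u != 1.

Lemma minimal_lobe_attachment x y z : x \in B -> y \in B :\ x -> z \in B :\ x ->
  ~~ connect (induced (B :\ x)) y z -> connect (induced (B :\ x)) y c.
Proof.
move=> xB yBx zBx not_yz; apply: contraT => not_yc.
pose S := [set u in B :\ x | connect (induced (B :\ x)) y u].
have lobeS : lobe (x |: S) x.
  apply/and3P; split; first by rewrite setU11.
    apply/eqP => /setP/(_ y); rewrite !inE connect0 andbT.
    by move: yBx; rewrite !inE => /andP[/negbTE-> ->].
  apply/forall_inP => u; rewrite !inE => /andP[ux].
  rewrite (negbTE ux) /= => /andP[uB yu].
  have uBc : u \in B :\ c by rewrite !inE uB andbT; apply: contraNneq not_yc => <-.
  rewrite (lobe_deg_gt0 lobeB uBc); apply/forallP => w; apply/implyP => uw.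
  have wB := lobe_closed lobeB uBc uw.
  rewrite !inE wB; case: eqVneq => //= wx; apply: connect_trans yu (connect1 _).
  by rewrite /induced /= uw !inE ux uB wx wB.
have := minB lobeS; rewrite leqNgt => /negP[]; apply/proper_card/properP; split.
  by apply/subsetP => u; rewrite !inE => /orP[/eqP->//|/andP[/andP[]]].
exists z; first by move: zBx; rewrite inE => /andP[].
by move: zBx; rewrite !inE (negbTE not_yz) => /andP[/negbTE-> ->].
Qed.

Lemma minimal_lobe_connected x y z : x \in B -> y \in B :\ x -> z \in B :\ x ->
  connect (induced (B :\ x)) y z.
Proof.
move=> xB yBx zBx; apply: contraT => not_yz; case/negP: (not_yz).
apply: connect_trans (minimal_lobe_attachment xB yBx zBx not_yz) _.
rewrite connect_induced_sym.
by apply: minimal_lobe_attachment yBx _; rewrite // connect_induced_sym.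
Qed.

Lemma minimal_lobe_path x y z : x \in B -> y \in B :\ x -> z \in B :\ x ->
  exists r, [/\ path e y r, last y r = z, uniq (y :: r) & {subset y :: r <= B :\ x}].
Proof.
by move=> xB yBx zBx; apply/(connect_induced_path yBx)/minimal_lobe_connected.
Qed.

Definition cycle_in s := [&& uniq s, cycle e s, 2 < size s & all [in B] s].

Lemma exists_cycle_in : exists s, cycle_in s.
Proof.
have [u uBc] : exists u, u \in B :\ c.
  case/and3P: lobeB => cB B_neq _; apply/set0Pn; apply: contra B_neq => /eqP Bc0.
  by rewrite -(setD1K cB) Bc0 setU0.
have uB : u \in B by move: uBc; rewrite inE => /andP[].
have /card_gt1P[y [z []]] : 1 < deg e u.
  by have := lobe_deg_gt0 lobeB uBc; have := deg_neq1 u; case: (deg e u) => [|[]].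
rewrite !inE => uy uz yz.
have in_BDu w : e u w -> w \in B :\ u.
  move=> uw; rewrite !inE (lobe_closed lobeB uBc uw) andbT.
  by apply: contraTneq uw => ->; rewrite e_irr.
have [r [y_r last_r r_uniq r_sub]] := minimal_lobe_path uB (in_BDu y uy) (in_BDu z uz).
exists [:: u, y & r]; apply/and4P; split.
- by rewrite cons_uniq r_uniq andbT; apply/negP => /r_sub; rewrite !inE eqxx.
- by rewrite /= rcons_path uy y_r last_r e_sym.
- by case: r last_r {y_r r_uniq r_sub} => //= yz'; rewrite yz' eqxx in yz.
- apply/allP => v; rewrite inE => /orP[/eqP-> //|/r_sub].
  by rewrite inE => /andP[].
Qed.

Lemma cycle_in_rot n s : cycle_in (rot n s) = cycle_in s.
Proof.
by rewrite /cycle_in rot_uniq rot_cycle size_rot (eq_all_r (mem_rot n s)).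
Qed.

Definition detour s p r q :=
  [&& p \in s, q \in s & p != q] && [&& r != [::], all [in B] r, uniq (r ++ s) &
    path e p (rcons r q)].

Lemma minimal_lobe_path_hitting s x z w : uniq s -> {subset s <= B} -> x \in B ->
    z \in B :\ x -> z \notin s -> w \in s -> w != x ->
  exists r q, [/\ q \in s, q != x, path e z (rcons r q), all [in B] (z :: r) &
    uniq ((z :: r) ++ s)].
Proof.
move=> s_uniq s_sub xB zBx zs ws wx.
have wBx : w \in B :\ x by rewrite !inE wx s_sub.
have [r0 [+ last_r0]] := minimal_lobe_path xB zBx wBx.
have r0_s : has [in s] r0.
  case: r0 last_r0 => [zw|a r last_r]; first by rewrite -zw (negbTE zs) in ws.
  by apply/hasP; exists w; rewrite // -last_r (mem_last a r).
case: (split_find r0_s) => q r r2 qs r_s; rewrite cat_path.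
move=> /andP[z_r _] r_uniq r_sub; exists r, q; split=> //.
- have : q \in B :\ x by apply: r_sub; rewrite inE mem_cat mem_rcons mem_head orbT.
  by rewrite !inE => /andP[].
- apply/allP => v v_r; have : v \in B :\ x.
    by apply: r_sub; rewrite -cat_cons mem_cat -rcons_cons mem_rcons inE v_r orbT.
  by rewrite !inE => /andP[].
- have : uniq (z :: r).
    apply: subseq_uniq r_uniq; rewrite -cat_cons; apply: subseq_trans (prefix_subseq _ _).
    by rewrite -rcons_cons subseq_rcons.
  by rewrite cat_uniq s_uniq => ->; rewrite has_sym /= negb_or zs r_s.
Qed.

Lemma exists_detour s : cycle_in s -> ~~ (B \subset s) -> exists p r q, detour s p r q.
Proof.
move=> /and4P[s_uniq _ s_size /allP s_sub] /subsetPn[y yB ys].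
have other x : exists2 x', x' \in s & x' != x.
  case: s s_uniq s_size {s_sub ys} => [|a [|b s]] //=.
  rewrite inE negb_or => /andP[/andP[ab _] _] _; have [ax|] := eqVneq a x.
    by exists b; rewrite ?inE ?eqxx ?orbT // -ax eq_sym.
  by exists a; rewrite ?inE ?eqxx.
have notin_D1 x z : x \in s -> z \in B -> z \notin s -> z \in B :\ x.
  by move=> xs zB zs; rewrite !inE zB andbT; apply: contraNneq zs => ->.
have [x xs _] := other y; have [w ws wx] := other x.
have [r0 [p [ps _ y_r0]]] :=
  minimal_lobe_path_hitting s_uniq s_sub (s_sub x xs) (notin_D1 x y xs yB ys) ys ws wx.
set z := last y r0 => /allP r0_sub; rewrite cat_uniq => /and3P[_ r0_s _].
have zB : z \in B by apply: r0_sub; rewrite mem_last.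
have zs : z \notin s.
  by apply: contra r0_s => zs; apply/hasP; exists z; rewrite //= mem_last.
have zp : e z p by move: y_r0; rewrite rcons_path => /andP[].
have [v vs vp] := other p.
have [r [q [qs qp z_r r_sub r_uniq]]] :=
  minimal_lobe_path_hitting s_uniq s_sub (s_sub p ps) (notin_D1 p z ps zB zs) zs vs vp.
by exists p, (z :: r), q; rewrite /detour ps qs eq_sym qp r_sub r_uniq /= e_sym zp z_r.
Qed.

Lemma cycle_in_two_paths p q r1 r2 : r1 != [::] ->
  all [in B] [:: p, q & r1 ++ r2] -> uniq [:: p, q & r1 ++ r2] ->
  path e p (rcons r1 q) -> path e p (rcons r2 q) -> cycle_in (p :: r1 ++ q :: rev r2).
Proof.
move=> r1_neq0 r12_sub r12_uniq p_r1 /path_rev_rcons q_r2.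
have r12_perm : perm_eq (p :: r1 ++ q :: rev r2) [:: p, q & r1 ++ r2].
  by rewrite perm_cons perm_catC /= perm_cons perm_catC perm_cat2l perm_rev.
apply/and4P; split.
- by rewrite (perm_uniq r12_perm).
- by rewrite /= rcons_cat rcons_cons -cat_rcons cat_path last_rcons p_r1.
- by rewrite (perm_size r12_perm) /= size_cat; case: (r1) r1_neq0.
- by rewrite (perm_all _ r12_perm).
Qed.

Lemma detour_longer_cycle s p r q : cycle_in s -> detour s p r q ->
  exists2 s', cycle_in s' & size s < size s'.
Proof.
move=> cyc_s /andP[/and3P[ps qs pq] /and4P[r_neq0 r_sub r_uniq p_r]].
have [i s0 s_rot] := rot_to ps.
have s_perm : perm_eq s (p :: s0) by rewrite -s_rot perm_sym perm_rot.
have : q \in s0 by move: qs; rewrite (perm_mem s_perm) inE eq_sym (negbTE pq).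
move: cyc_s; rewrite -(cycle_in_rot i) s_rot => cyc_s qs0.
case/splitPr: qs0 s_perm cyc_s => s1 s2' s_perm /and4P[_ s_cycle _ s_sub].
have [s2 s2E] : exists s2, s2' = rev s2 by exists (rev s2'); rewrite revK.
rewrite {s2'}s2E in s_perm s_cycle s_sub.
have r_perm : perm_eq (r ++ s) [:: p, q & r ++ s1 ++ s2].
  rewrite (perm_catl r s_perm) perm_catC /= perm_cons -catA perm_catCA /= perm_cons.
  by rewrite perm_catC -catA perm_catCA !perm_cat2l perm_rev.
move: r_uniq; rewrite (perm_uniq r_perm) => rs_uniq.
have rs_sub : all [in B] [:: p, q & r ++ s1 ++ s2].
  by rewrite -(perm_all _ r_perm) all_cat r_sub (perm_all _ s_perm).
have size_s : size s = (size s1 + size s2).+2.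
  by rewrite (perm_size s_perm) /= size_cat /= size_rev addnS.
move: s_cycle; rewrite /= rcons_cat rcons_cons -cat_rcons cat_path last_rcons.
move=> /andP[p_s1 /path_rev_rcons]; rewrite revK => p_s2.
have size_detour s3 : size (p :: r ++ q :: rev s3) = (size r + size s3).+2.
  by rewrite /= size_cat /= size_rev addnS.
have r_gt0 : 0 < size r by rewrite lt0n size_eq0.
have [s10|s1_neq0] := eqVneq s1 [::].
  exists (p :: r ++ q :: rev s2).
    by apply: cycle_in_two_paths => //; [move: rs_sub | move: rs_uniq]; rewrite s10.
  by rewrite size_s size_detour s10 !ltnS ltn_add2r.
have [s20|s2_neq0] := eqVneq s2 [::].
  exists (p :: r ++ q :: rev s1).
    by apply: cycle_in_two_paths => //; [move: rs_sub | move: rs_uniq]; rewrite s20 cats0.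
  by rewrite size_s size_detour s20 addnC !ltnS ltn_add2r.
by have := no_theta even_t r_neq0 s1_neq0 s2_neq0 p_r p_s1 p_s2; rewrite rs_uniq.
Qed.

Lemma minimal_lobe_hamiltonian : exists2 s, cycle_in s & s =i B.
Proof.
pose has_cycle n := [exists s : n.-tuple V, cycle_in s].
have ex_cycle : exists n, has_cycle n.
  have [s cyc_s] := exists_cycle_in.
  by exists (size s); apply/existsP; exists (in_tuple s).
have bounded n : has_cycle n -> n <= #|V|.
  move=> /existsP[s /and4P[s_uniq _ _ _]].
  by rewrite -(size_tuple s) -(card_uniqP s_uniq) max_card.
case: (ex_maxnP ex_cycle bounded) => n /existsP[s cyc_s] longest.
exists s => // y; apply/idP/idP => [|yB].
  by case/and4P: cyc_s => _ _ _ /allP; apply.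
have [/subsetP/(_ y yB)//|s_proper] := boolP (B \subset s).
have [p [r [q /(detour_longer_cycle cyc_s)[s' cyc_s']]]] := exists_detour cyc_s s_proper.
rewrite size_tuple ltnNge longest //.
by apply/existsP; exists (in_tuple s').
Qed.

End MinimalLobe.

End Lobes.

(** * Reducible configurations *)

Section ReducibleConfigurations.
Variables (V : finType) (e : rel V).
Hypotheses (e_sym : symmetric e) (e_irr : irreflexive e).
Implicit Types (u s w t x r y : V).

Definition cap u s w := [&& e u s, e s w, e u w & deg e s == 2].

Definition two_caps u s w t x :=
  [&& uniq [:: u; s; w; t; x], cap u s w, cap w t x & deg e w == 4].

Definition three_caps u s w t x r y :=
  [&& uniq [:: u; s; w; t; x; r; y], two_caps u s w t x, cap x r y & deg e x == 4].

Definition reducible : Prop :=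
  [\/ exists x y, [/\ e x y, deg e x = 2 & deg e y = 2],
      exists u s w, cap u s w /\ deg e w = 3,
      exists u s w t x, two_caps u s w t x /\ e u x |
      exists u s w t x r y, three_caps u s w t x r y].

Lemma cap_sym u s w : cap u s w = cap w s u.
Proof. by rewrite /cap (e_sym u w) (e_sym u s) (e_sym s w) andbCA. Qed.

Section OuterCycle.
Variables (n : nat) (v : nat -> V).
Hypothesis v_inj : {in gtn n &, injective v}.
Hypothesis v_step : forall i, i.+1 < n -> e (v i) (v i.+1).
Hypothesis v_close : e (v 0) (v n.-1).
Hypothesis v_nbr : forall i w, 0 < i < n -> e (v i) w -> exists2 j, j < n & w = v j.
Hypothesis v_cross : forall i j k l, i < j -> j < k -> k < l -> l < n ->
  e (v i) (v k) -> e (v j) (v l) -> False.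

Lemma uniq_outer_cycle js : uniq js -> all (gtn n) js -> uniq (map v js).
Proof.
move=> js_uniq /allP js_lt; rewrite map_inj_in_uniq // => i j /js_lt i_lt /js_lt j_lt.
exact: v_inj.
Qed.

Lemma deg_outer_cycle k js : 0 < k < n -> uniq js -> all (gtn n) js ->
  all (fun j => e (v k) (v j)) js ->
  (forall j, j < n -> e (v k) (v j) -> j \in js) -> deg e (v k) = size js.
Proof.
move=> k_bound js_uniq js_lt /allP js_nbr nbr_js.
rewrite -(size_map v) -(card_uniqP (uniq_outer_cycle js_uniq js_lt)).
apply: eq_card => w; rewrite inE; apply/idP/mapP => [kw|[j /js_nbr kj ->//]].
have [j j_lt wE] := v_nbr k_bound kw; exists j => //.
by apply: nbr_js; rewrite -?wE.
Qed.

Lemma triangle_reducible : n = 3 -> reducible.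
Proof.
move=> nE; have irr k : e (v k) (v k) = false by exact: e_irr.
have e01 : e (v 0) (v 1) by apply: v_step; rewrite nE.
have e12 : e (v 1) (v 2) by apply: v_step; rewrite nE.
have e02 : e (v 0) (v 2) by move: v_close; rewrite nE.
have [e10 e20 e21] : [/\ e (v 1) (v 0), e (v 2) (v 0) & e (v 2) (v 1)].
  by rewrite !(e_sym (v 2)) (e_sym (v 1)).
constructor 1; exists (v 1), (v 2); split=> //.
  apply: (@deg_outer_cycle 1 [:: 0; 2]); rewrite ?nE //= ?e10 ?e12 //.
  by case=> [|[|[|k]]] //; rewrite irr.
apply: (@deg_outer_cycle 2 [:: 0; 1]); rewrite ?nE //= ?e20 ?e21 //.
by case=> [|[|[|k]]] //; rewrite irr.
Qed.

Lemma exists_shortest_chord : 3 < n -> exists i j,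
  [/\ i.+2 < j, j < n, e (v i) (v j) & forall a b, i <= a -> b <= j -> a.+2 < b ->
    e (v a) (v b) -> a = i /\ b = j].
Proof.
move=> n_gt3; have n_gt0 : 0 < n by lia.
have last_lt : n.-1 < n by rewrite prednK.
pose chord (ij : 'I_n * 'I_n) := (ij.1.+2 < ij.2) && e (v ij.1) (v ij.2).
have chord0 : chord (Ordinal n_gt0, Ordinal last_lt) by rewrite /chord /= v_close andbT; lia.
case: (arg_minnP (fun ij : 'I_n * 'I_n => ij.2 - ij.1) chord0) => -[i j].
move=> /andP[/= ij_lt ij] minimal.
exists i, j; split=> // a b ia bj ab eab.
have b_lt : b < n := leq_ltn_trans bj (ltn_ord j).
have a_lt : a < n by lia.
by have := minimal (Ordinal a_lt, Ordinal b_lt); rewrite /chord /= ab eab => /(_ isT); lia.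
Qed.

Section ShortestChord.
Variables (i j : nat).
Hypotheses (ij_lt : i.+2 < j) (j_lt : j < n) (e_ij : e (v i) (v j)).
Hypothesis shortest : forall a b, i <= a -> b <= j -> a.+2 < b -> e (v a) (v b) ->
  a = i /\ b = j.

Definition capped k := [&& i < k, k < j & e (v k.-1) (v k.+1)].

Lemma inner_nbr k m : i < k < j -> m < n -> e (v k) (v m) ->
  [&& i <= m <= j, m <= k.+2, k <= m.+2 & m != k].
Proof.
move=> /andP[ik kj] m_lt km; have mk : e (v m) (v k) by rewrite e_sym.
have im : i <= m by rewrite leqNgt; apply/negP => mi; exact: (@v_cross m i k j).
have mj : m <= j by rewrite leqNgt; apply/negP => jm; exact: (@v_cross i k j m).
apply/and4P; split; first by rewrite im.
- by rewrite leqNgt; apply/negP => km2; have := shortest (ltnW ik) mj km2 km; lia.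
- by rewrite leqNgt; apply/negP => mk2; have := shortest im (ltnW kj) mk2 mk; lia.
- by apply: contraTneq km => ->; rewrite e_irr.
Qed.

Lemma capped_neighbor k : capped k -> capped k.+1 = false.
Proof.
move=> /and3P[ik kj ek]; apply/negP => /and3P[_ kj' ek'].
by apply: (@v_cross k.-1 k k.+1 k.+2); rewrite // -?[k.+2]/(k.+1.+1); lia.
Qed.

Lemma deg_inner k : i <= k -> k.+1 < j ->
  deg e (v k.+1) = (capped k + capped k.+2).+2.
Proof.
move=> ik kj; pose js := k :: k.+2 :: nseq (capped k) k.-1 ++ nseq (capped k.+2) k.+3.
have -> : (capped k + capped k.+2).+2 = size js by rewrite /= size_cat !size_nseq.
have e_k : e (v k.+1) (v k) by rewrite e_sym v_step //; lia.
have e_k2 : e (v k.+1) (v k.+2) by rewrite v_step //; lia.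
have ik' : capped k -> i < k by case/and3P.
have kj' : capped k.+2 -> k.+2 < j by case/and3P.
apply: deg_outer_cycle; first lia.
- rewrite /js; move: (capped k) (capped k.+2) ik' kj' {js} => [] [] ik' kj';
    rewrite /= ?inE; lia.
- by rewrite /js /= all_cat !all_nseq /=; lia.
- rewrite /js /= e_k e_k2 all_cat !all_nseq /=; apply/andP; split.
    by case: (boolP (capped k)) => //= /and3P[_ _]; rewrite e_sym.
  by case: (boolP (capped k.+2)) => //= /and3P[].
move=> m m_lt km; have := inner_nbr _ m_lt km; rewrite ltnS ik kj => /(_ isT) m_near.
rewrite !inE mem_cat !mem_nseq !lt0b.
have [mk|mk] := eqVneq m k.-1.
  by rewrite /capped -mk e_sym km; lia.
have [mk2|mk2] := eqVneq m k.+3; last by lia.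
by rewrite /capped /= -mk2 km; lia.
Qed.

Lemma capped_cap k : capped k.+1 -> cap (v k) (v k.+1) (v k.+2).
Proof.
move=> capped_k1; have /and3P[ik kj /= ek] := capped_k1.
have not_capped_k : capped k = false.
  by apply: contraTF capped_k1 => /capped_neighbor->.
have deg_k1 : deg e (v k.+1) = 2 by rewrite deg_inner // not_capped_k capped_neighbor.
by rewrite /cap ek deg_k1 !v_step //; lia.
Qed.

Lemma shortest_chord_reducible : reducible.
Proof.
have not_capped_i : capped i = false by rewrite /capped ltnn.
have deg_i1 : deg e (v i.+1) = (capped i.+2).+2 by rewrite deg_inner ?not_capped_i //; lia.
have deg_i2 : deg e (v i.+2) = (capped i.+1 + capped i.+3).+2 by rewrite deg_inner.
have [capped1|] := boolP (capped i.+1); last first.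
  rewrite -eqbF_neg => /eqP not_capped1.
  have [capped2|] := boolP (capped i.+2).
    constructor 2; exists (v i.+3), (v i.+2), (v i.+1).
    by rewrite cap_sym capped_cap // deg_i1 capped2.
  rewrite -eqbF_neg => /eqP not_capped2.
  have [capped3|] := boolP (capped i.+3).
    constructor 2; exists (v i.+4), (v i.+3), (v i.+2).
    by rewrite cap_sym capped_cap // deg_i2 not_capped1 capped3.
  rewrite -eqbF_neg => /eqP not_capped3.
  constructor 1; exists (v i.+1), (v i.+2).
  rewrite deg_i1 deg_i2 not_capped1 not_capped2 not_capped3 v_step //; lia.
have [capped3|not_capped3] := boolP (capped i.+3); last first.
  constructor 2; exists (v i), (v i.+1), (v i.+2).
  by rewrite capped_cap // deg_i2 capped1 (negbTE not_capped3).
have deg_i2_4 : deg e (v i.+2) = 4 by rewrite deg_i2 capped1 capped3.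
have j_gt : i.+3 < j by case/and3P: capped3.
have two : two_caps (v i) (v i.+1) (v i.+2) (v i.+3) (v i.+4).
  rewrite /two_caps deg_i2_4 !capped_cap // andbT.
  by apply: (@uniq_outer_cycle [:: i; i.+1; i.+2; i.+3; i.+4]); rewrite /= ?inE; lia.
have [jE|j_neq] := eqVneq j i.+4.
  by constructor 3; exists (v i), (v i.+1), (v i.+2), (v i.+3), (v i.+4); rewrite -{2}jE.
have deg_i4 : deg e (v i.+4) = (capped i.+3 + capped i.+4.+1).+2.
  by rewrite deg_inner //; lia.
have [capped5|not_capped5] := boolP (capped i.+4.+1); last first.
  constructor 2; exists (v i.+2), (v i.+3), (v i.+4).
  by rewrite capped_cap // deg_i4 capped3 (negbTE not_capped5).
constructor 4; exists (v i), (v i.+1), (v i.+2), (v i.+3), (v i.+4), (v i.+4.+1), (v i.+4.+2).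
apply/and4P; split=> //; [|exact: capped_cap|by rewrite deg_i4 capped3 capped5].
apply: (@uniq_outer_cycle [:: i; i.+1; i.+2; i.+3; i.+4; i.+4.+1; i.+4.+2]).
  by rewrite /= !inE; lia.
by have /and3P[_ ? _] := capped5; rewrite /=; lia.
Qed.

End ShortestChord.

Lemma outer_cycle_reducible : 2 < n -> reducible.
Proof.
rewrite leq_eqVlt => /orP[/eqP/esym|/exists_shortest_chord]; first exact: triangle_reducible.
by case=> i [j [ij_lt j_lt ij shortest]]; exact: shortest_chord_reducible shortest.
Qed.

End OuterCycle.

End ReducibleConfigurations.

Section EvenTournamentReducible.
Variables (V : finType) (e t : rel V).
Hypotheses (e_sym : symmetric e) (e_irr : irreflexive e).
Hypothesis even_t : even_tournament e t.

Lemma hamiltonian_lobe_reducible (B : {set V}) (c : V) (s : seq V) :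
  lobe e B c -> s =i B -> uniq s -> cycle e s -> 2 < size s -> reducible e.
Proof.
move=> lobeB sB s_uniq s_cycle s_size.
have cs : c \in s by rewrite sB; case/and3P: lobeB.
have [i r r_rot] := rot_to cs.
move: s_uniq s_cycle s_size; rewrite -(rot_uniq i) -(rot_cycle i) -(size_rot i) r_rot.
move=> r_uniq r_cycle r_size.
have {}sB u : (u \in c :: r) = (u \in B) by rewrite -r_rot mem_rot.
have := r_cycle; rewrite /= rcons_path => /andP[c_r r_c].
apply: (@outer_cycle_reducible _ e e_sym e_irr (size (c :: r)) (nth c (c :: r))) => //.
- by move=> j k j_lt k_lt /eqP; rewrite nth_uniq // => /eqP.
- by move=> j j_lt; exact: (pathP c c_r).
- by rewrite e_sym -[X in e (nth _ _ X)]/(size r) -last_nth.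
- move=> j w /andP[j_gt0 j_lt] jw.
  have jB : nth c (c :: r) j \in B :\ c.
    rewrite !inE -sB mem_nth // andbT -[X in _ != X]/(nth c (c :: r) 0).
    by rewrite nth_uniq // -lt0n.
  have wr : w \in c :: r by rewrite sB; exact: lobe_closed lobeB jB jw.
  by exists (index w (c :: r)); rewrite ?index_mem ?nth_index.
- by move=> j k l m; exact: (cycle_no_crossing_chords even_t r_uniq r_cycle).
Qed.

Lemma even_tournament_reducible : (exists u, 0 < deg e u) -> (forall u, deg e u != 1) ->
  reducible e.
Proof.
move=> [u du] deg_neq1.
case: (@arg_minnP ({set V} * V)%type ([set v | 0 < deg e v], u)
  (fun Bc => lobe e Bc.1 Bc.2) (fun Bc => #|Bc.1|)); first exact: lobe_nonisolated.
case=> B c /= lobeB minimal.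
have minB B' c' : lobe e B' c' -> #|B| <= #|B'| by exact: (minimal (B', c')).
have [s /and4P[s_uniq s_cycle s_size _] sB] :=
  minimal_lobe_hamiltonian e_sym e_irr even_t lobeB minB deg_neq1.
exact: hamiltonian_lobe_reducible lobeB sB s_uniq s_cycle s_size.
Qed.

End EvenTournamentReducible.

(** * Arc colorings *)

Section Saturation.
Variable T : finType.
Implicit Types (S U : {set T}) (a b c p q : T).

Definition saturated S U := (#|S| <= 1) ==> [disjoint S & U].

Lemma saturated_large S U : 1 < #|S| -> saturated S U.
Proof. by rewrite /saturated ltnNge => /negbTE->. Qed.

Lemma saturated_disjoint S U : [disjoint S & U] -> saturated S U.
Proof. by rewrite /saturated => ->; exact: implybT. Qed.

Lemma saturated_notin S U c : c \in S -> c \notin U -> saturated S U.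
Proof.
move=> cS cU; apply/implyP => S_le1.
have /eqP <- : [set c] == S by rewrite eqEcard sub1set cS cards1.
by rewrite disjoints1.
Qed.

Lemma leq_cardsD1 S a : #|S|.-1 <= #|S :\ a|.
Proof. by rewrite (cardsD1 a S); case: (a \in S); rewrite ?leq_pred. Qed.

Lemma exists_in_setD1 S a : 1 < #|S| -> exists b, b \in S :\ a.
Proof.
by move=> S_gt1; apply/card_gt0P; apply: leq_trans (leq_cardsD1 S a); case: #|S| S_gt1.
Qed.

Lemma saturated_pick S U : 0 < #|S| -> #|U| = #|S| -> saturated S U ->
  exists a b, [/\ a \in S, b \in U, a != b & saturated (S :\ a) (U :\ b)].
Proof.
move=> S_gt0 US satSU; have [disSU|] := boolP [disjoint S & U].
  have [a aS] := card_gt0P S_gt0; have [b bU] : exists b, b \in U.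
    by apply/card_gt0P; rewrite US.
  exists a, b; split=> //.
    by apply: contraTneq bU => <-; rewrite (disjointFr disSU aS).
  apply/saturated_disjoint/(disjointWl (subD1set _ _)).
  exact: disjointWr (subD1set _ _) disSU.
move=> meetSU; have S_gt1 : 1 < #|S|.
  by rewrite ltnNge; apply: contra meetSU => /(implyP satSU).
move: meetSU; rewrite disjoint_subset => /subsetPn[c cS]; rewrite inE negbK => cU.
have [a] := exists_in_setD1 c S_gt1; rewrite !inE => /andP[ac aS].
by exists a, c; split=> //; apply: (@saturated_notin _ _ c); rewrite !inE ?eqxx // eq_sym ac.
Qed.

Lemma saturated_pick_avoiding S U a b : 1 < #|S| -> #|U| = #|S| -> a != b ->
  (exists c, [/\ S = [set a; c], U = [set b; c], a != c & b != c]) \/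
  exists p q, [/\ p \in S :\ a, q \in U :\ b, p != q & saturated (S :\ p) (U :\ q)].
Proof.
move=> S_gt1 US ab; have U_gt1 : 1 < #|U| by rewrite US.
have [S_gt2|S_le2] := ltnP 2 #|S|.
  have [p pSa] := exists_in_setD1 a S_gt1; right.
  have [q] : exists q, q \in U :\ b :\ p.
    by apply: exists_in_setD1; apply: leq_trans (leq_cardsD1 U b); rewrite US; case: #|S| S_gt2.
  rewrite in_setD1 => /andP[qp qUb]; exists p, q; split; rewrite 1?eq_sym //.
  by apply: saturated_large; apply: leq_trans (leq_cardsD1 S p); case: #|S| S_gt2.
have [disSU|] := boolP [disjoint S & U].
  have [p pSa] := exists_in_setD1 a S_gt1; have [q qUb] := exists_in_setD1 b U_gt1.
  right; exists p, q; split=> //.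
    move: pSa qUb; rewrite !inE => /andP[_ pS] /andP[_].
    by apply: contraTneq => <-; rewrite (disjointFr disSU pS).
  apply/saturated_disjoint/(disjointWl (subD1set _ _)).
  exact: disjointWr (subD1set _ _) disSU.
rewrite disjoint_subset => /subsetPn[c cS]; rewrite inE negbK => cU.
have pair (A : {set T}) : c \in A -> #|A| = 2 -> exists2 y, y != c & A = [set y; c].
  move=> cA A2; have /cards1P[y yE] : #|A :\ c| == 1 by rewrite -eqSS -A2 (cardsD1 c A) cA.
  exists y; last by rewrite setUC -yE setD1K.
  by have : y \in A :\ c; [rewrite yE set11 | rewrite !inE => /andP[]].
have S2 : #|S| = 2 by apply/eqP; rewrite eqn_leq S_le2.
have [y yc SE] := pair S cS S2; have [z zc UE] := pair U cU (etrans US S2).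
rewrite {}SE {}UE {S_gt1 US U_gt1 S_le2 cS cU S2 pair}.
have [ya_cb|] := boolP ((y != a) && (c != b)).
  right; exists y, c; rewrite !inE !eqxx orbT; case/andP: ya_cb => -> ->; split=> //.
  by apply: (@saturated_notin _ _ c); rewrite !inE !eqxx ?orbT // eq_sym yc.
have [ca_zb _|] := boolP ((c != a) && (z != b)).
  right; exists c, z; rewrite !inE !eqxx orbT; case/andP: ca_zb => -> ->.
  split=> //; first by rewrite eq_sym.
  apply: (@saturated_notin _ _ y); rewrite !inE ?yc ?eqxx //.
  by rewrite (negbTE yc) orbF andNb.
rewrite !negb_and !negbK => ca_or_zb ya_or_cb; left; exists c.
case/orP: ca_or_zb ya_or_cb => /eqP cz_eq /orP[] /eqP yc_eq.
- by rewrite yc_eq cz_eq eqxx in yc.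
- by rewrite -yc_eq cz_eq eqxx in ab.
- by rewrite -yc_eq -cz_eq.
- by rewrite cz_eq -yc_eq eqxx in zc.
Qed.

Lemma exists_subset_card S n : n <= #|S| -> exists2 S' : {set T}, S' \subset S & #|S'| = n.
Proof.
move=> /card_geqP[s [s_uniq s_size s_sub]]; exists [set x in s].
  by apply/subsetP => x; rewrite inE => /s_sub.
by rewrite cardsE (card_uniqP s_uniq).
Qed.

Lemma saturated_reserve n S U : 0 < n -> n <= #|S| -> #|U| = #|S| -> exists S' U',
  [/\ S' \subset S, U' \subset U, #|S'| = n, #|U'| = n & saturated (S :\: S') (U :\: U')].
Proof.
move=> n_gt0 nS US.
have [Sn|Sn|Sn] := ltngtP #|S| n.+1.
- exists S, U; have Sn' : #|S| = n by apply/eqP; rewrite eqn_leq nS -ltnS Sn.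
  split; rewrite ?US //.
  by apply: saturated_disjoint; rewrite setDv disjoints_subset sub0set.
- have [S' sS' cS'] := exists_subset_card nS.
  have [U' sU' cU'] := exists_subset_card (leq_trans nS (eq_leq (esym US))).
  exists S', U'; split=> //; apply: saturated_large.
  by rewrite cardsD (setIidPr sS') cS' ltn_subRL addn1.
- have S_gt1 : 1 < #|S| by rewrite Sn.
  have [a aS] := card_gt0P (ltnW S_gt1).
  have [b] := exists_in_setD1 a (leq_trans S_gt1 (eq_leq (esym US))).
  rewrite !inE => /andP[ba bU]; exists (S :\ a), (U :\ b); rewrite !subD1set; split=> //.
  + by apply: succn_inj; rewrite -Sn (cardsD1 a S) aS.
  + by apply: succn_inj; rewrite -Sn -US (cardsD1 b U) bU.
  apply: (@saturated_notin _ _ a); rewrite !inE ?eqxx ?aS //.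
  by rewrite eq_sym ba andNb.
Qed.

End Saturation.

Section ArcColorings.
Variables (V : finType) (D : nat).
Implicit Types (e P : rel V) (u v w x y : V) (k a b : 'I_D).

(* [C u v k] says that the incidence (u, uv), viewed as the arc from u to v,
   has color k; arcs off the support of C are uncolored. *)
Definition arc_coloring := V -> V -> 'I_D -> bool.
Implicit Types C L : arc_coloring.

Definition converse C : arc_coloring := fun u v k => C v u k.

Definition proper C := [/\
  forall u v k k', C u v k -> C u v k' -> k = k',
  forall u v k, C u v k -> exists k', C v u k',
  forall u v k, C u v k -> ~~ C v u k,
  forall u v w k, C u v k -> C u w k -> v = w &
  forall u v w k, C v u k -> C w u k -> v = w].

Definition supports e C := forall u v, e u v = [exists k, C u v k].

Definition free_out C u := [set k | [forall v, ~~ C u v k]].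
Definition free_in C u := free_out (converse C) u.

(* As [free_out C u] has [D - deg e u] elements, saturation is condition (d). *)
Definition conditional_coloring e C :=
  [/\ proper C, supports e C & forall u, saturated (free_out C u) (free_in C u)].

Definition colorable e := exists C, conditional_coloring e C.

Lemma free_outP C u k : reflect (forall v, ~~ C u v k) (k \in free_out C u).
Proof. by rewrite inE; exact: forallP. Qed.

Lemma free_inP C u k : reflect (forall v, ~~ C v u k) (k \in free_in C u).
Proof. exact: free_outP. Qed.

Lemma proper_converse C : proper C -> proper (converse C).
Proof. by case=> c_fun c_sym c_neq c_out c_in; split=> *; eauto. Qed.

Lemma card_free_out C e u : proper C -> supports e C -> #|free_out C u| = D - deg e u.
Proof.
move=> [c_fun _ _ c_out _] C_e; pose S := [set z : V * 'I_D | C u z.1 z.2].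
have nbrE : [set v | e u v] = fst @: S.
  apply/setP => v; rewrite inE C_e.
  apply/existsP/imsetP => [[k Ck]|[[v' k]]]; last by rewrite inE /= => Ck ->; exists k.
  by exists (v, k); rewrite ?inE.
have freeE : free_out C u = ~: (snd @: S).
  apply/setP => k; rewrite [RHS]inE; apply/free_outP/negP => [free_k /imsetP[[v k']]|not_k v].
    by rewrite inE /= => Ck kE; move: Ck; rewrite -kE; apply/negP.
  by apply/negP => Ck; apply/not_k/imsetP; exists (v, k); rewrite ?inE.
rewrite /deg nbrE freeE cardsCs setCK card_ord !card_in_imset // => -[v k] [v' k'].
  by rewrite !inE /= => Ck + vv'; rewrite -vv' => /(c_fun _ _ _ _ Ck) ->.
by rewrite !inE /= => Ck + kk'; rewrite -kk' => /(c_out _ _ _ _ Ck) ->.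
Qed.

Lemma card_free_in C e u : symmetric e -> proper C -> supports e C ->
  #|free_in C u| = D - deg e u.
Proof.
move=> e_sym C_proper C_e; apply: card_free_out (proper_converse C_proper) _.
by move=> v w; rewrite e_sym C_e.
Qed.

Lemma card_free_meet C e u v : symmetric e -> proper C -> supports e C ->
  deg e u + deg e v + 2 <= D -> 1 < #|free_out C u :&: free_in C v|.
Proof.
move=> e_sym C_proper C_e deg_uv.
have := cardsUI (free_out C u) (free_in C v).
have := max_card (free_out C u :|: free_in C v); rewrite card_ord.
rewrite (card_free_out u C_proper C_e) (card_free_in v e_sym C_proper C_e).
move: deg_uv; clear; lia.
Qed.

Lemma free_setT C e u : symmetric e -> proper C -> supports e C -> deg e u = 0 ->
  free_out C u = setT /\ free_in C u = setT.
Proof.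
move=> e_sym C_proper C_e deg0.
split; apply/eqP; rewrite eqEcard subsetT cardsT card_ord.
  by rewrite (card_free_out u C_proper C_e) deg0 subn0 leqnn.
by rewrite (card_free_in u e_sym C_proper C_e) deg0 subn0 leqnn.
Qed.

Lemma free_deg1 C e u v a b : symmetric e -> proper C -> supports e C -> deg e u = 1 ->
  C u v a -> C v u b -> free_out C u = [set~ a] /\ free_in C u = [set~ b].
Proof.
move=> e_sym C_proper C_e deg1 ua vb.
have compl (A : {set 'I_D}) k : #|A| = D - 1 -> k \notin A -> A = [set~ k].
  move=> cardA kA; apply/eqP; rewrite eqEcard cardsC1 card_ord cardA subn1 leqnn andbT.
  by apply/subsetP => k' k'A; rewrite !inE; apply: contraNneq kA => <-.
split; apply: compl.
- by rewrite (card_free_out u C_proper C_e) deg1.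
- by apply/negP => /free_outP/(_ v); rewrite ua.
- by rewrite (card_free_in u e_sym C_proper C_e) deg1.
- by apply/negP => /free_inP/(_ v); rewrite vb.
Qed.

Lemma saturated_deg C e u : proper C -> supports e C ->
  (deg e u + 2 <= D) || (deg e u == D) -> saturated (free_out C u) (free_in C u).
Proof.
move=> C_proper C_e; have := card_free_out u C_proper C_e.
move=> cardC /orP[degD|/eqP degD].
  by apply: saturated_large; rewrite cardC ltn_subRL -addnS.
apply: saturated_disjoint; move: cardC; rewrite degD subnn => /cards0_eq->.
by rewrite disjoints_subset sub0set.
Qed.

Definition union C L : arc_coloring := fun u v k => C u v k || L u v k.

Lemma free_out_union C L u : free_out (union C L) u = free_out C u :&: free_out L u.
Proof.
apply/setP => k; rewrite [RHS]inE.
apply/free_outP/andP => [free_CL|[/free_outP free_C /free_outP free_L] v].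
  by split; apply/free_outP => v; have := free_CL v; rewrite negb_or => /andP[].
by rewrite negb_or free_C free_L.
Qed.

Lemma free_in_union C L u : free_in (union C L) u = free_in C u :&: free_in L u.
Proof. exact: free_out_union. Qed.

Lemma proper_union C L : proper C -> proper L ->
  (forall u v k k', C u v k -> ~~ L u v k') ->
  (forall u v k, L u v k -> k \in free_out C u /\ k \in free_in C v) ->
  proper (union C L).
Proof.
move=> [C_fun C_sym C_neq C_out C_in] [L_fun L_sym L_neq L_out L_in] disCL free.
have not_both u v k k' : C u v k -> L u v k' -> False.
  by move=> Ck; apply/negP/(disCL _ _ _ _ Ck).
have not_both_out u v w k : C u v k -> L u w k -> False.
  by move=> Ck /free[/free_outP/(_ v)]; rewrite Ck.
have not_both_in u v w k : C v u k -> L w u k -> False.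
  by move=> Ck /free[_ /free_inP/(_ v)]; rewrite Ck.
split.
- move=> u v k k' /orP[Ck|Lk] /orP[Ck'|Lk']; [exact: C_fun Ck Ck'| | |exact: L_fun Lk Lk'].
  + by case: (not_both _ _ _ _ Ck Lk').
  + by case: (not_both _ _ _ _ Ck' Lk).
- by move=> u v k /orP[/C_sym|/L_sym] [k' vu_k']; exists k'; rewrite /union vu_k' ?orbT.
- move=> u v k /orP[Ck|Lk]; rewrite negb_or.
  + by rewrite (C_neq _ _ _ Ck); apply/negP => /L_sym[k' /(not_both _ _ _ _ Ck)].
  + by rewrite (L_neq _ _ _ Lk) andbT; apply/negP => /C_sym[k' Ck]; exact: not_both Ck Lk.
- move=> u v w k /orP[Ck|Lk] /orP[Ck'|Lk']; [exact: C_out Ck Ck'| | |exact: L_out Lk Lk'].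
  + by case: (not_both_out _ _ _ _ Ck Lk').
  + by case: (not_both_out _ _ _ _ Ck' Lk).
- move=> u v w k /orP[Ck|Lk] /orP[Ck'|Lk']; [exact: C_in Ck Ck'| | |exact: L_in Lk Lk'].
  + by case: (not_both_in _ _ _ _ Ck Lk').
  + by case: (not_both_in _ _ _ _ Ck' Lk).
Qed.

Definition del e P : rel V := fun u v => e u v && ~~ P u v.

Lemma del_sym e P : symmetric e -> symmetric P -> symmetric (del e P).
Proof. by move=> e_sym P_sym u v; rewrite /del e_sym P_sym. Qed.

Lemma deg_del e P u (vs : seq V) : uniq vs -> (forall v, e u v && P u v = (v \in vs)) ->
  deg (del e P) u + size vs = deg e u.
Proof.
move=> vs_uniq vsE; rewrite /deg -(cardsID [set v | P u v] [set v | e u v]) addnC.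
congr (_ + _); last by apply: eq_card => v; rewrite !inE /del andbC.
by rewrite -(card_uniqP vs_uniq); apply: eq_card => v; rewrite !inE -vsE.
Qed.

Lemma supports_union e P C L : subrel P e -> supports (del e P) C -> supports P L ->
  supports e (union C L).
Proof.
move=> P_e C_del L_P u v.
transitivity (del e P u v || P u v).
  by rewrite /del; case: (boolP (P u v)) => [/P_e->|_]; rewrite ?andbT ?orbF ?orbT.
rewrite C_del L_P; apply/orP/existsP => [[]/existsP[k uv_k]|[k /orP[]uv_k]].
- by exists k; rewrite /union uv_k.
- by exists k; rewrite /union uv_k orbT.
- by left; apply/existsP; exists k.
- by right; apply/existsP; exists k.
Qed.

Lemma colorable_union e P C L : subrel P e -> conditional_coloring (del e P) C ->
  proper L -> supports P L ->
  (forall u v k, L u v k -> k \in free_out C u /\ k \in free_in C v) ->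
  (forall u v, P u v -> [|| deg e u + 2 <= D, deg e u == D |
    saturated (free_out (union C L) u) (free_in (union C L) u)]) ->
  colorable e.
Proof.
move=> P_e [C_proper C_del C_sat] L_proper L_P free sat.
have CL_e := supports_union P_e C_del L_P.
have CL_proper : proper (union C L).
  apply: proper_union => // u v k k' Ck; apply/negP => Lk'.
  have : del e P u v by rewrite C_del; apply/existsP; exists k.
  by rewrite /del L_P => /andP[_ /existsP[]]; exists k'.
exists (union C L); split=> // u.
have [/existsP[v /sat]|/existsPn not_P] := boolP [exists v, P u v].
  by rewrite orbA => /orP[/(saturated_deg CL_proper CL_e)|].
have L_u v k : ~~ L u v k.
  by apply: contra (not_P v) => Lk; rewrite L_P; apply/existsP; exists k.
rewrite free_out_union free_in_union.
suff [-> ->] : free_out L u = setT /\ free_in L u = setT by rewrite !setIT.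
split; apply/setP => k; rewrite [RHS]inE; first by apply/free_outP.
have [_ L_sym _ _ _] := L_proper; apply/free_inP => v.
by apply/negP => /L_sym[k']; apply/negP.
Qed.

Definition pair_rel x y : rel V :=
  fun u v => (u == x) && (v == y) || (u == y) && (v == x).

Definition edge_coloring x y a b : arc_coloring :=
  fun u v k => [&& u == x, v == y & k == a] || [&& u == y, v == x & k == b].

Lemma pair_rel_sym x y : symmetric (pair_rel x y).
Proof. by move=> u v; rewrite /pair_rel orbC !(andbC (v == _)). Qed.

Lemma sub_pair_rel e x y : symmetric e -> e x y -> subrel (pair_rel x y) e.
Proof. by move=> e_sym exy u v /orP[]/andP[/eqP-> /eqP->]; rewrite // e_sym. Qed.

Lemma deg_del_pair e x y : symmetric e -> e x y -> x != y ->
  deg (del e (pair_rel x y)) x + 1 = deg e x /\ deg (del e (pair_rel x y)) y + 1 = deg e y.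
Proof.
move=> e_sym exy xy; split.
  apply: (@deg_del _ _ _ [:: y]) => // v; rewrite inE /pair_rel eqxx (negbTE xy) orbF /=.
  by apply: andb_idl => /eqP->.
apply: (@deg_del _ _ _ [:: x]) => // v; rewrite inE /pair_rel eqxx (eq_sym y) (negbTE xy) /=.
by apply: andb_idl => /eqP->; rewrite e_sym.
Qed.

Lemma supports_edge x y a b : supports (pair_rel x y) (edge_coloring x y a b).
Proof.
move=> u v; apply/orP/existsP => [[]/andP[/eqP-> /eqP->]|[k /orP[]/and3P[ux vy _]]].
- by exists a; rewrite /edge_coloring !eqxx.
- by exists b; rewrite /edge_coloring !eqxx orbT.
- by left; rewrite ux vy.
- by right; rewrite ux vy.
Qed.

Lemma proper_edge x y a b : x != y -> a != b -> proper (edge_coloring x y a b).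
Proof.
rewrite /edge_coloring => xy ab.
have [yx ba] : y != x /\ b != a by rewrite eq_sym xy eq_sym.
split.
- by move=> u v k k' /orP[]/and3P[/eqP-> /eqP-> /eqP->];
    rewrite !eqxx ?(negbTE xy) ?(negbTE yx) ?orbF => /eqP.
- by move=> u v k /orP[]/and3P[-> -> _]; [exists b | exists a]; rewrite eqxx ?orbT.
- by move=> u v k /orP[]/and3P[/eqP-> /eqP-> /eqP->];
    rewrite !eqxx ?(negbTE xy) ?(negbTE yx) ?(negbTE ab) ?(negbTE ba).
- by move=> u v w k /orP[]/and3P[/eqP-> /eqP-> /eqP->];
    rewrite !eqxx ?(negbTE xy) ?(negbTE yx) ?orbF ?andbT /= => /eqP->.
- by move=> u v w k /orP[]/and3P[/eqP-> /eqP-> /eqP->];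
    rewrite !eqxx ?(negbTE xy) ?(negbTE yx) ?andbF ?orbF ?andbT /= => /eqP->.
Qed.

Lemma eq_free_out C L u : (forall v k, C u v k = L u v k) -> free_out C u = free_out L u.
Proof. by move=> CL; apply/setP => k; rewrite !inE; apply: eq_forallb => v; rewrite CL. Qed.

Lemma free_edge_coloring x y a b : x != y ->
  [/\ free_out (edge_coloring x y a b) x = [set~ a],
      free_out (edge_coloring x y a b) y = [set~ b],
      free_in (edge_coloring x y a b) x = [set~ b] &
      free_in (edge_coloring x y a b) y = [set~ a]].
Proof.
have free_l u v c d : u != v -> free_out (edge_coloring u v c d) u = [set~ c].
  move=> uv; apply/setP => k; rewrite in_setC1; apply/free_outP/idP => [/(_ v)|kc w];
    rewrite /edge_coloring !eqxx (negbTE uv) orbF //.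
  by rewrite (negbTE kc) andbF.
move=> xy; have yx : y != x by rewrite eq_sym.
split; first exact: free_l.
- by rewrite -(free_l y x b a yx); apply: eq_free_out => v k; exact: orbC.
- rewrite -(free_l x y b a xy); apply: eq_free_out => v k.
  by rewrite /converse /edge_coloring orbC; congr (_ || _); rewrite andbCA.
- rewrite -(free_l y x a b yx); apply: eq_free_out => v k.
  by rewrite /converse /edge_coloring; congr (_ || _); rewrite andbCA.
Qed.

Lemma colorable_edge e C x y a b : symmetric e -> e x y -> x != y ->
  conditional_coloring (del e (pair_rel x y)) C -> a != b ->
  a \in free_out C x -> a \in free_in C y -> b \in free_in C x -> b \in free_out C y ->
  saturated (free_out C x :\ a) (free_in C x :\ b) ->
  saturated (free_out C y :\ b) (free_in C y :\ a) -> colorable e.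
Proof.
move=> e_sym exy xy C_cond ab ax ay bx b_y sat_x sat_y.
apply: (colorable_union (sub_pair_rel e_sym exy) C_cond (proper_edge xy ab)
  (supports_edge x y a b)) => [u v k|u v].
  by case/orP=> /and3P[/eqP-> /eqP-> /eqP->].
have [out_x out_y in_x in_y] := free_edge_coloring a b xy.
rewrite free_out_union free_in_union.
by case/orP=> /andP[/eqP-> _]; rewrite ?out_x ?out_y ?in_x ?in_y -!setDE ?sat_x ?sat_y !orbT.
Qed.

End ArcColorings.

Section Reductions.
Variables (V : finType) (D : nat) (e : rel V).
Hypotheses (e_sym : symmetric e) (e_irr : irreflexive e).
Hypothesis deg_le : forall u, deg e u <= D.
Hypothesis colorable_del : forall P : rel V, symmetric P ->
  (exists u v, e u v && P u v) -> colorable D (del e P).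

Lemma neq_of_edge u v : e u v -> u != v.
Proof. by apply: contraTneq => ->; rewrite e_irr. Qed.

Lemma colorable_del_pair x y : e x y -> colorable D (del e (pair_rel x y)).
Proof.
move=> exy; apply: colorable_del; first exact: pair_rel_sym.
by exists x, y; rewrite exy /pair_rel !eqxx.
Qed.

Lemma saturated_low_deg f (C : arc_coloring V D) u a (U : {set 'I_D}) :
  proper C -> supports f C -> deg f u + 3 <= D -> saturated (free_out C u :\ a) U.
Proof.
move=> C_proper C_f degD; apply/saturated_large/(leq_trans _ (leq_cardsD1 _ _)).
by rewrite (card_free_out u C_proper C_f); lia.
Qed.

Lemma colorable_leaf u v : 2 < D -> e u v -> deg e v = 1 -> colorable D e.
Proof.
move=> D_gt2 uv deg_v; have [C C_cond] := colorable_del_pair uv.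
have [C_proper C_sup C_sat] := C_cond.
have del_s : symmetric (del e (pair_rel u v)) := del_sym e_sym (pair_rel_sym u v).
have [deg_u deg_v'] := deg_del_pair e_sym uv (neq_of_edge uv).
have deg_v0 : deg (del e (pair_rel u v)) v = 0 by lia.
have cardC := card_free_out u C_proper C_sup.
have free_u : 0 < #|free_out C u| by rewrite cardC; have := deg_le u; lia.
have [|a [b [au bu ab sat_u]]] := saturated_pick free_u _ (C_sat u).
  by rewrite cardC (card_free_in u del_s C_proper C_sup).
have [out_v in_v] := free_setT del_s C_proper C_sup deg_v0.
apply: (colorable_edge e_sym uv (neq_of_edge uv) C_cond ab) => //; rewrite ?out_v ?in_v //.
by rewrite -out_v; apply: (saturated_low_deg _ _ C_proper C_sup); rewrite deg_v0.
Qed.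

Lemma colorable_edge_deg2 x y : 3 < D -> e x y -> deg e x = 2 -> deg e y = 2 -> colorable D e.
Proof.
move=> D_gt3 xy deg_x deg_y; have [C C_cond] := colorable_del_pair xy.
have [C_proper C_sup _] := C_cond.
have del_s : symmetric (del e (pair_rel x y)) := del_sym e_sym (pair_rel_sym x y).
have [deg_x' deg_y'] := deg_del_pair e_sym xy (neq_of_edge xy).
have {deg_x deg_x'}deg_x : deg (del e (pair_rel x y)) x = 1 by lia.
have {deg_y deg_y'}deg_y : deg (del e (pair_rel x y)) y = 1 by lia.
have meet u v : deg (del e (pair_rel x y)) u = 1 -> deg (del e (pair_rel x y)) v = 1 ->
    1 < #|free_out C u :&: free_in C v|.
  by move=> deg_u deg_v; apply: (card_free_meet del_s C_proper C_sup); rewrite deg_u deg_v.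
have [a] := card_gt0P (ltnW (meet x y deg_x deg_y)).
have [b] := exists_in_setD1 a (meet y x deg_y deg_x).
rewrite !inE => /and3P[ba b_y b_x] /andP[a_x a_y].
apply: (colorable_edge e_sym xy (neq_of_edge xy) C_cond (a := a) (b := b)) => //.
- by rewrite eq_sym.
- by rewrite inE.
- by rewrite inE.
- by rewrite inE.
- by rewrite inE.
- by apply: (saturated_low_deg _ _ C_proper C_sup); rewrite deg_x.
- by apply: (saturated_low_deg _ _ C_proper C_sup); rewrite deg_y.
Qed.

Lemma conflicting_cap_colors (C : arc_coloring V D) u v w a b c : proper C -> v != w ->
  C u v a -> C v u b -> (exists r, C u w r) -> a != b -> a != c -> b != c ->
  free_out C w = [set a; c] -> free_in C w = [set b; c] -> 4 < D.
Proof.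
move=> [_ C_sym C_neq C_out C_in] vw ua vb [r ur] ab ac bc out_w in_w.
have [s ws] := C_sym _ _ _ ur.
have rs : r != s by apply: contraTneq ws => <-; exact: C_neq ur.
have ra : r != a by apply: contraNneq vw => ra; rewrite (C_out _ _ _ _ ua (_ : C u w a)) // -ra.
have sb : s != b by apply: contraNneq vw => sb; rewrite (C_in _ _ _ _ vb (_ : C w u b)) // -sb.
have r_used k : k \in free_in C w -> r != k.
  by move=> /free_inP/(_ u); apply: contraNneq => <-.
have s_used k : k \in free_out C w -> s != k.
  by move=> /free_outP/(_ u); apply: contraNneq => <-.
have uniq_colors : uniq [:: r; s; a; b; c].
  rewrite /= !inE !negb_or rs ra sb ab ac bc !r_used ?s_used //;
    by rewrite ?in_w ?out_w !inE eqxx ?orbT.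
by have := max_card [in [:: r; s; a; b; c]]; rewrite (card_uniqP uniq_colors) card_ord.
Qed.

Lemma colorable_cap u v w : 3 < D -> cap e u v w -> deg e w <= maxn 3 (D - 2) -> colorable D e.
Proof.
move=> D_gt3 /and4P[uv vw uw' /eqP deg_v] deg_w.
have uw := neq_of_edge uw'; have wv : e w v by rewrite e_sym.
have [C C_cond] := colorable_del_pair wv; have [C_proper C_sup C_sat] := C_cond.
set f := del e (pair_rel w v) in C_cond C_sup.
have del_s : symmetric f := del_sym e_sym (pair_rel_sym w v).
have [deg_w' deg_v'] := deg_del_pair e_sym wv (neq_of_edge wv); rewrite -/f in deg_w' deg_v'.
have [a ua] : exists a, C u v a.
  apply/existsP; rewrite -C_sup /f /del uv /pair_rel (negbTE uw).
  by rewrite (negbTE (neq_of_edge uv)).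
have [_ C_sym C_neq _ _] := C_proper; have [b vb] := C_sym _ _ _ ua.
have ab : a != b by apply: contraTneq vb => <-; exact: C_neq ua.
have deg_v1 : deg f v = 1 by move: deg_v deg_v'; clear; lia.
have [out_v in_v] := free_deg1 del_s C_proper C_sup deg_v1 vb ua.
have card_w := card_free_out w C_proper C_sup.
have free_w : 1 < #|free_out C w| by rewrite card_w; move: deg_w deg_w' D_gt3; clear; lia.
have in_out_w : #|free_in C w| = #|free_out C w|.
  by rewrite card_w (card_free_in w del_s C_proper C_sup).
have [[c [out_w in_w ac bc]]|] := saturated_pick_avoiding free_w in_out_w ab.
  have w2 : #|free_out C w| = 2 by rewrite out_w cards2 ac.
  have uw_colored : exists r, C u w r.
    apply/existsP; rewrite -C_sup /f /del uw' /pair_rel (negbTE uw).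
    by rewrite (negbTE (neq_of_edge uv)).
  have := conflicting_cap_colors C_proper (neq_of_edge vw) ua vb uw_colored ab ac bc out_w in_w.
  by move: w2 card_w deg_w deg_w'; clear; lia.
case=> p [q [+ + pq sat_w]]; rewrite !in_setD1 => /andP[pa pS] /andP[qb qU].
apply: (colorable_edge e_sym wv (neq_of_edge wv) C_cond pq pS _ qU _ sat_w).
- by rewrite in_v !inE.
- by rewrite out_v !inE.
by apply: (saturated_low_deg _ _ C_proper C_sup); rewrite deg_v1.
Qed.

End Reductions.

(** * Extending colorings by finite search *)

(* A local coloring is a list of ((i, j), k): the arc from vertex i to vertex
   j of a configuration has color k. [ao] and [ai] list, for each vertex, the
   colors allowed on its outgoing and incoming arcs; [full] lists vertices at
   which all allowed colors must be used, [cov] those at which every color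
   must occur. *)
Section LocalColorings.
Variables (D m : nat) (arcs : seq (nat * nat)) (full cov : seq nat).
Implicit Types (ao ai : seq (seq nat)) (l : seq (nat * nat * nat)).

Definition out_colors l i := [seq z.2 | z <- l & z.1.1 == i].
Definition in_colors l i := [seq z.2 | z <- l & z.1.2 == i].

Definition compatible (z z' : nat * nat * nat) :=
  [&& (z.1 == z'.1) ==> (z.2 == z'.2),
      (z.1.1 == z'.1.1) && (z.2 == z'.2) ==> (z.1.2 == z'.1.2),
      (z.1.2 == z'.1.2) && (z.2 == z'.2) ==> (z.1.1 == z'.1.1) &
      (z.1.1 == z'.1.2) && (z.1.2 == z'.1.1) ==> (z.2 != z'.2)].

Definition valid ao ai l :=
  [&& all (fun z => [&& z.1.1 < m, z.1.2 < m, z.2 < D, z.1 \in arcs,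
             z.2 \in nth [::] ao z.1.1 & z.2 \in nth [::] ai z.1.2]) l,
      all (fun z => all (compatible z) l) l,
      all (fun p => ((p.2, p.1) \in arcs) && has (fun z => z.1 == p) l) arcs,
      all (fun i => all [in out_colors l i] (nth [::] ao i) &&
                    all [in in_colors l i] (nth [::] ai i)) full &
      all (fun i => all [in out_colors l i ++ in_colors l i] (iota 0 D)) cov].

Fixpoint solve ao ai todo l : option (seq (nat * nat * nat)) :=
  if todo is (i, j) :: todo' then
    (fix try ks := if ks is k :: ks' then
       if (k \in nth [::] ai j) && all (compatible (i, j, k)) l then
         if solve ao ai todo' ((i, j, k) :: l) is Some r then Some r else try ks'
       else try ks' else None) (nth [::] ao i)
  else if valid ao ai l then Some l else None.

Lemma solve_valid ao ai : isSome (solve ao ai arcs [::]) -> exists l, valid ao ai l.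
Proof.
elim: arcs [::] => [|[i j] todo IH] l /=; first by case: ifP => // l_valid; exists l.
elim: (nth [::] ao i) => // k ks IHks /=; case: ifP => // _.
by case E: (solve _ _ _ _) => [r|//] _; apply: (IH ((i, j, k) :: l)); rewrite E.
Qed.

End LocalColorings.

Lemma map_index_cat (T : eqType) (s r : seq T) : uniq s ->
  [seq index x (s ++ r) | x <- s] = iota 0 (size s).
Proof.
case: s => // x0 s s_uniq.
apply: (@eq_from_nth _ 0) => [|i]; rewrite size_map ?size_iota // => i_lt.
by rewrite (nth_map x0) // index_cat mem_nth // index_uniq // nth_iota.
Qed.

Section ColorCode.
Variables (D : nat) (cs : seq 'I_D).
Hypotheses (cs_uniq : uniq cs) (cs_size : size cs = D).
Implicit Types (k : 'I_D) (O : {set 'I_D}).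

Definition code O := [seq index k cs | k <- cs & k \in O].

Lemma mem_color_seq k : k \in cs.
Proof.
have sub : {subset cs <= enum 'I_D} by move=> i _; rewrite mem_enum.
have [|_ ->] := uniq_min_size cs_uniq sub; last by rewrite mem_enum.
by rewrite cs_size size_enum_ord.
Qed.

Lemma index_color_inj : injective (index^~ cs).
Proof.
by move=> k k' kk'; rewrite -(nth_index k (mem_color_seq k)) kk' nth_index ?mem_color_seq.
Qed.

Lemma mem_code O k : (index k cs \in code O) = (k \in O).
Proof. by rewrite /code (mem_map index_color_inj) mem_filter mem_color_seq andbT. Qed.

Lemma size_code O : size (code O) = #|O|.
Proof.
rewrite size_map -(card_uniqP (filter_uniq [in O] cs_uniq)).
by apply: eq_card => k; rewrite mem_filter mem_color_seq andbT.
Qed.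

Lemma map_index_color : [seq index k cs | k <- cs] = iota 0 D.
Proof. by have := map_index_cat [::] cs_uniq; rewrite cats0 cs_size. Qed.

Lemma code_setT : code setT = iota 0 D.
Proof.
rewrite /code (eq_filter (a2 := predT)) ?filter_predT ?map_index_color //.
by move=> k; rewrite inE.
Qed.

Lemma code_subseq O : subseq (code O) (iota 0 D).
Proof. by rewrite -map_index_color map_subseq ?filter_subseq. Qed.

End ColorCode.

Lemma code_prefix D (O : {set 'I_D}) : code (enum O ++ enum (~: O)) O = iota 0 #|O|.
Proof.
rewrite /code filter_cat.
have /all_filterP -> : all [in O] (enum O) by apply/allP => k; rewrite mem_enum.
have -> : [seq k <- enum (~: O) | k \in O] = [::].
  by apply/eqP; rewrite -[_ == _]negbK -has_filter; apply/hasPn => k; rewrite mem_enum inE.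
by rewrite cats0 map_index_cat ?enum_uniq // cardE.
Qed.

Lemma uniq_enum_cat_setC D (O : {set 'I_D}) :
  uniq (enum O ++ enum (~: O)) /\ size (enum O ++ enum (~: O)) = D.
Proof.
rewrite cat_uniq !enum_uniq size_cat -!cardE cardsC card_ord andbT; split=> //.
by apply/hasPn => k; rewrite !mem_enum inE.
Qed.

Fixpoint sublists (s : seq nat) : seq (seq nat) :=
  if s is x :: s' then map (cons x) (sublists s') ++ sublists s' else [:: [::]].

Lemma mem_sublists r s : subseq r s -> r \in sublists s.
Proof.
elim: s r => [|x s IH] [|y r] //=; rewrite mem_cat; first by rewrite IH ?sub0seq ?orbT.
by case: eqP => [->|_] /IH => [r_s|->]; rewrite ?map_f ?orbT.
Qed.

Definition choices n D := [seq s <- sublists (iota 0 D) | size s == n].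

Section Lift.
Variables (V : finType) (D : nat).
Variables (vs : seq V) (arcs : seq (nat * nat)) (cs : seq 'I_D) (full cov : seq nat).
Variables (AO AI : V -> {set 'I_D}) (l : seq (nat * nat * nat)).
Hypotheses (vs_uniq : uniq vs) (cs_uniq : uniq cs) (cs_size : size cs = D).
Implicit Types (u v w : V) (k : 'I_D).

Definition local_rel : rel V := fun u v => (index u vs, index v vs) \in arcs.

Definition lift : arc_coloring V D :=
  fun u v k => (index u vs, index v vs, index k cs) \in l.

Let ao := [seq code cs (AO v) | v <- vs].
Let ai := [seq code cs (AI v) | v <- vs].
Hypothesis l_valid : valid D (size vs) arcs full cov ao ai l.

Lemma index_vertex_inj u v : u \in vs -> index u vs = index v vs -> u = v.
Proof.
move=> u_vs uv; have v_vs : v \in vs by rewrite -index_mem -uv index_mem.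
by rewrite -(nth_index u u_vs) uv nth_index.
Qed.

Lemma nth_codes (A : V -> {set 'I_D}) u k : u \in vs ->
  (index k cs \in nth [::] [seq code cs (A v) | v <- vs] (index u vs)) = (k \in A u).
Proof.
by move=> u_vs; rewrite (nth_map u) ?index_mem // nth_index // mem_code.
Qed.

Lemma lift_entry u v k : lift u v k ->
  [/\ u \in vs, v \in vs, local_rel u v, k \in AO u & k \in AI v].
Proof.
move=> uv; case/and5P: l_valid => /allP/(_ _ uv)/and5P[/= + + _ uv_arc +] _ _ _ _.
by rewrite !index_mem => u_vs v_vs; rewrite !nth_codes // => /andP[-> ->].
Qed.

Lemma lift_compatible u v k u' v' k' : lift u v k -> lift u' v' k' ->
  compatible (index u vs, index v vs, index k cs) (index u' vs, index v' vs, index k' cs).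
Proof. by move=> uv uv'; case/and5P: l_valid => _ /allP/(_ _ uv)/allP/(_ _ uv'). Qed.

Lemma lift_of_entry z : z \in l -> exists u v k, lift u v k /\
  z = (index u vs, index v vs, index k cs).
Proof.
case: z => -[i j] k zl; case/and5P: l_valid => /allP/(_ _ zl)/and5P[/= i_lt j_lt k_lt _ _] _ _ _ _.
have u0 : V by case: (vs) i_lt.
have k0 : 'I_D by case: (D) k_lt => // n _; exact: ord0.
exists (nth u0 vs i), (nth u0 vs j), (nth k0 cs k).
by rewrite /lift !index_uniq ?cs_size.
Qed.

Lemma supports_lift : supports local_rel lift.
Proof.
move=> u v; apply/idP/existsP => [uv|[k /lift_entry[]//]].
case/and5P: l_valid => _ _ /allP/(_ _ uv)/andP[_ /hasP[z zl /eqP zE]] _ _.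
have [u' [v' [k [uv' z_eq]]]] := lift_of_entry zl.
by exists k; move: uv'; rewrite /lift; move: zE; rewrite z_eq /= => -> .
Qed.

Lemma proper_lift : proper lift.
Proof.
split=> [u v k k' uv uv'|u v k|u v k uv|u v w k uv uw|u v w k vu wu].
- have /and4P[/= same_arc _ _ _] := lift_compatible uv uv'.
  by apply: (index_color_inj cs_uniq cs_size); apply/eqP; move: same_arc; rewrite eqxx.
- case/lift_entry=> _ _ uv _ _.
  case/and5P: l_valid => _ _ /allP/(_ _ uv)/andP[/= vu _] _ _.
  have : local_rel v u by [].
  by rewrite supports_lift => /existsP.
- apply/negP => vu; have /and4P[/= _ _ _] := lift_compatible uv vu.
  by rewrite !eqxx.
- have /and4P[/= _ + _ _] := lift_compatible uv uw; rewrite !eqxx /= => /eqP.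
  by apply: index_vertex_inj; case: (lift_entry uv).
- have /and4P[/= _ _ + _] := lift_compatible vu wu; rewrite !eqxx /= => /eqP.
  by apply: index_vertex_inj; case: (lift_entry vu).
Qed.

Lemma mem_out_colors u k : u \in vs -> index k cs \in out_colors l (index u vs) ->
  k \notin free_out lift u.
Proof.
move=> u_vs /mapP[z]; rewrite mem_filter => /andP[+ zl].
have [u' [v [k' [uv ->]]]] := lift_of_entry zl.
move=> /= /eqP/esym/(index_vertex_inj u_vs) -> /(index_color_inj cs_uniq cs_size) ->.
by apply/negP => /free_outP/(_ v); rewrite uv.
Qed.

Lemma mem_in_colors u k : u \in vs -> index k cs \in in_colors l (index u vs) ->
  k \notin free_in lift u.
Proof.
move=> u_vs /mapP[z]; rewrite mem_filter => /andP[+ zl].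
have [v [u' [k' [vu ->]]]] := lift_of_entry zl.
move=> /= /eqP/esym/(index_vertex_inj u_vs) -> /(index_color_inj cs_uniq cs_size) ->.
by apply/negP => /free_inP/(_ v); rewrite vu.
Qed.

Lemma free_lift_full u : u \in vs -> index u vs \in full ->
  free_out lift u = ~: AO u /\ free_in lift u = ~: AI u.
Proof.
move=> u_vs u_full; case/and5P: l_valid => _ _ _ /allP/(_ _ u_full) + _.
case/andP=> /allP out_full /allP in_full.
split; apply/setP => k; rewrite [RHS]inE; apply/idP/idP => [|kA].
- by apply: contraTN; rewrite -nth_codes // => /out_full; exact: mem_out_colors.
- by apply/free_outP => v; apply: contra kA => /lift_entry[].
- by apply: contraTN; rewrite -nth_codes // => /in_full; exact: mem_in_colors.
- by apply/free_inP => v; apply: contra kA => /lift_entry[].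
Qed.

Lemma disjoint_free_lift_cov u : u \in vs -> index u vs \in cov ->
  [disjoint free_out lift u & free_in lift u].
Proof.
move=> u_vs u_cov; case/and5P: l_valid => _ _ _ _ /allP/(_ _ u_cov)/allP all_used.
rewrite disjoint_subset; apply/subsetP => k k_out; rewrite inE.
have : index k cs \in iota 0 D.
  by rewrite mem_iota -[X in _ < _ + X]cs_size index_mem (mem_color_seq cs_uniq cs_size).
move=> /all_used; rewrite mem_cat => /orP[/(mem_out_colors u_vs)|]; first by rewrite k_out.
exact: mem_in_colors.
Qed.

Lemma colorable_lift (e : rel V) C :
  subrel local_rel e -> conditional_coloring (del e local_rel) C ->
  {in vs, forall u, AO u \subset free_out C u /\ AI u \subset free_in C u} ->
  {in vs, forall u, [\/ index u vs \in full /\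
                      saturated (free_out C u :\: AO u) (free_in C u :\: AI u),
                      deg e u + 2 <= D, deg e u = D | index u vs \in cov]} ->
  colorable D e.
Proof.
move=> local_e C_cond allowed sat.
have free u v k : lift u v k -> k \in free_out C u /\ k \in free_in C v.
  case/lift_entry=> /allowed[/subsetP AO_u _] /allowed[_ /subsetP AI_v] _ kO kI.
  by split; [exact: AO_u | exact: AI_v].
apply: (colorable_union local_e C_cond proper_lift supports_lift free) => u v.
rewrite supports_lift => /existsP[k /lift_entry[u_vs _ _ _ _]].
have [[u_full sat_u]|->//|->|u_cov] := sat u u_vs; rewrite ?eqxx ?orbT //.
  have [out_u in_u] := free_lift_full u_vs u_full.
  by rewrite free_out_union free_in_union out_u in_u -!setDE sat_u !orbT.
rewrite saturated_disjoint ?orbT // free_out_union free_in_union.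
apply: (disjointWl (subsetIr _ _)); apply: (disjointWr (subsetIr _ _)).
exact: disjoint_free_lift_cov.
Qed.

End Lift.

Definition both_ways (edges : seq (nat * nat)) :=
  flatten [seq [:: p; (p.2, p.1)] | p <- edges].

Definition nbrs (arcs : seq (nat * nat)) i := [seq p.2 | p <- arcs & p.1 == i].

Definition end_bounds D p (A B : seq nat) := A :: rcons (nseq p (iota 0 D)) B.

(* The configuration has [p] inner vertices 1, ..., p and is attached to the rest
   of the graph at 0 and p + 1, where each time [n] colors are reserved for the
   outgoing and [n] for the incoming arcs; up to renaming colors, those for the
   arcs that leave 0 are 0, ..., n - 1. *)
Definition extendable D p arcs n cov :=
  all (fun in0 => all (fun out1 => all (fun in1 =>
    isSome (solve D p.+2 arcs [:: 0; p.+1] cov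
      (end_bounds D p (iota 0 n) out1) (end_bounds D p in0 in1) arcs [::]))
  (choices n D)) (choices n D)) (choices n D).

Section Configuration.
Variables (V : finType) (D : nat) (e : rel V).
Hypotheses (e_sym : symmetric e) (deg_le : forall u, deg e u <= D).
Hypothesis colorable_del : forall P : rel V, symmetric P ->
  (exists u v, e u v && P u v) -> colorable D (del e P).

Variables (u x : V) (inner : seq V) (edges : seq (nat * nat)) (n : nat) (cov : seq nat).
Let vs := u :: rcons inner x.
Let arcs := both_ways edges.
Let config := local_rel vs arcs.
Hypotheses (vs_uniq : uniq vs) (n_gt0 : 0 < n) (arcs_uniq : uniq arcs).
Hypothesis edges_e : all (fun p =>
  [&& p.1 < size vs, p.2 < size vs & e (nth u vs p.1) (nth u vs p.2)]) edges.

Lemma both_ways_sym i j : (i, j) \in arcs -> (j, i) \in arcs.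
Proof.
move=> /flatten_mapP[[i' j'] p_edge ij]; apply/flatten_mapP; exists (i', j') => //.
by move: ij; rewrite !inE /= => /orP[] /eqP[-> ->]; rewrite eqxx ?orbT.
Qed.

Lemma config_sym : symmetric config.
Proof. by move=> v w; apply/idP/idP => /both_ways_sym. Qed.

Lemma arcs_e i j : (i, j) \in arcs ->
  [/\ i < size vs, j < size vs & e (nth u vs i) (nth u vs j)].
Proof.
move=> /flatten_mapP[[i' j'] /(allP edges_e)/and3P[/= i'_lt j'_lt eij]].
by rewrite !inE => /orP[] /eqP[-> ->]; rewrite // e_sym.
Qed.

Lemma config_sub : subrel config e.
Proof.
move=> v w /arcs_e[]; rewrite !index_mem => v_vs w_vs.
by rewrite !nth_index.
Qed.

Lemma deg_del_config v : v \in vs ->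
  deg (del e config) v + size (nbrs arcs (index v vs)) = deg e v.
Proof.
move=> v_vs; rewrite -(size_map (nth u vs)); apply: deg_del => [|w].
  rewrite /nbrs -map_comp map_inj_in_uniq ?filter_uniq // => -[i j] [i' j'].
  rewrite !mem_filter /= => /andP[/eqP-> /arcs_e[_ j_lt _]] /andP[/eqP-> /arcs_e[_ j'_lt _]].
  by move=> /eqP; rewrite nth_uniq // => /eqP->.
apply/andP/mapP => [[_ vw]|[_ /mapP[[i j] + ->] ->]].
  have [_ w_vs _] := arcs_e vw; exists (index w vs); last by rewrite nth_index // -index_mem.
  by apply/mapP; exists (index v vs, index w vs); rewrite // mem_filter eqxx.
rewrite mem_filter => /andP[/eqP iv ij]; have {}iv : i = index v vs := iv.
have [_ j_lt] := arcs_e ij; rewrite iv nth_index // => -> .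
by rewrite /config /local_rel index_uniq // -iv.
Qed.

Hypotheses (size_nbrs_l : size (nbrs arcs 0) = n)
  (size_nbrs_r : size (nbrs arcs (size inner).+1) = n).
Hypothesis inner_deg : all (fun i => let v := nth u vs i in
  (size (nbrs arcs i) == deg e v) && [|| deg e v + 2 <= D, deg e v == D | i \in cov])
  (iota 1 (size inner)).
Hypothesis ext : extendable D (size inner) arcs n cov.

Lemma index_l : index u vs = 0. Proof. by rewrite /= eqxx. Qed.

Lemma index_r : index x vs = (size inner).+1.
Proof.
have <- : nth u vs (size inner).+1 = x by rewrite /= nth_rcons ltnn eqxx.
by rewrite index_uniq //= size_rcons.
Qed.

Lemma inner_vertex v : v \in vs -> v != u -> v != x -> deg (del e config) v = 0 /\
  [\/ deg e v + 2 <= D, deg e v = D | index v vs \in cov].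
Proof.
move=> v_vs vu vx; have v_inner : v \in inner.
  by move: v_vs; rewrite inE (negbTE vu) mem_rcons inE (negbTE vx).
have iv : index v vs \in iota 1 (size inner).
  by rewrite /= eq_sym (negbTE vu) -cats1 index_cat v_inner mem_iota add1n /= ltnS index_mem.
have := allP inner_deg _ iv; rewrite nth_index // => /andP[/eqP size_nbrs deg_v]; split.
  by apply/eqP; rewrite -(eqn_add2r (deg e v)) add0n -{1}size_nbrs deg_del_config.
by case/or3P: deg_v => [|/eqP|] deg_v; constructor.
Qed.

Lemma config_nonempty : exists v w, e v w && config v w.
Proof.
have [[i j] ij] : exists p, p \in arcs.
  by move: size_nbrs_l n_gt0; case: arcs => [<-|p r _ _] //; exists p; rewrite mem_head.
have [i_lt j_lt eij] := arcs_e ij.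
by exists (nth u vs i), (nth u vs j); rewrite eij /config /local_rel !index_uniq.
Qed.

Lemma reserve_end C v : conditional_coloring (del e config) C ->
  deg (del e config) v + n = deg e v -> exists O I : {set 'I_D},
  [/\ O \subset free_out C v, I \subset free_in C v, #|O| = n, #|I| = n &
      saturated (free_out C v :\: O) (free_in C v :\: I)].
Proof.
move=> [C_proper C_sup _] deg_v; apply: saturated_reserve => //.
  rewrite (card_free_out v C_proper C_sup) -[X in X <= _](addKn (deg (del e config) v)).
  by rewrite deg_v leq_sub2r.
have del_s : symmetric (del e config) := del_sym e_sym config_sym.
by rewrite (card_free_in v del_s C_proper C_sup) (card_free_out v C_proper C_sup).
Qed.

Definition ends (A B : {set 'I_D}) v := if v == u then A else if v == x then B else setT.

Lemma ends_codes cs A B : uniq cs -> size cs = D ->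
  [seq code cs (ends A B v) | v <- vs] = end_bounds D (size inner) (code cs A) (code cs B).
Proof.
move=> cs_uniq cs_size; have := vs_uniq.
rewrite /= mem_rcons inE negb_or eq_sym rcons_uniq => /andP[/andP[xu u_inner] /andP[x_inner _]].
rewrite /end_bounds map_rcons /ends eqxx (negbTE xu) eqxx; congr (_ :: rcons _ _).
rewrite -[in RHS](size_map (fun v => code cs (ends A B v)) inner); apply/all_pred1P/allP.
move=> _ /mapP[v v_inner ->] /=; rewrite /ends.
have [vu|_] := eqVneq v u; first by rewrite -vu v_inner in u_inner.
have [vx|_] := eqVneq v x; first by rewrite -vx v_inner in x_inner.
by rewrite code_setT.
Qed.

Lemma colorable_configuration : colorable D e.
Proof.
have [C C_cond] := colorable_del config_sym config_nonempty.
have u_vs : u \in vs by rewrite mem_head.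
have x_vs : x \in vs by rewrite inE mem_rcons mem_head orbT.
have [|Ou [Iu [Ou_free Iu_free card_Ou card_Iu sat_u]]] := @reserve_end C u C_cond.
  by rewrite -size_nbrs_l -index_l deg_del_config.
have [|Ox [Ix [Ox_free Ix_free card_Ox card_Ix sat_x]]] := @reserve_end C x C_cond.
  by rewrite -size_nbrs_r -index_r deg_del_config.
pose cs := enum Ou ++ enum (~: Ou); have [cs_uniq cs_size] := uniq_enum_cat_setC Ou.
have code_Ou : code cs Ou = iota 0 n by rewrite code_prefix card_Ou.
have choice (A : {set 'I_D}) : #|A| = n -> code cs A \in choices n D.
  by move=> cardA; rewrite mem_filter size_code // cardA eqxx mem_sublists // code_subseq.
have := allP (allP (allP ext _ (choice Iu card_Iu)) _ (choice Ox card_Ox)) _ (choice Ix card_Ix).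
have size_vs : size vs = (size inner).+2 by rewrite /= size_rcons.
move=> /solve_valid[l]; rewrite -code_Ou -!(@ends_codes cs) // -size_vs => l_valid.
apply: (colorable_lift vs_uniq cs_uniq cs_size l_valid config_sub C_cond) => v v_vs.
  rewrite /ends; case: eqVneq => [->|vu]; first by split.
  case: eqVneq => [->|vx]; first by split.
  have [C_proper C_sup _] := C_cond; have [deg0 _] := inner_vertex v_vs vu vx.
  by have [-> ->] := free_setT (del_sym e_sym config_sym) C_proper C_sup deg0.
rewrite /ends; case: eqVneq => [->|vu]; first by constructor 1; rewrite index_l.
case: eqVneq => [->|vx]; first by constructor 1; rewrite index_r !inE eqxx orbT.
by have [_ []] := inner_vertex v_vs vu vx; [constructor 2|constructor 3|constructor 4].
Qed.

End Configuration.

(* The order of the edges only matters for the speed of the search. *)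
Definition two_caps_edges := [:: (0, 2); (0, 1); (2, 4); (3, 4); (1, 2); (2, 3)].
Definition closed_caps_edges :=
  [:: (0, 1); (0, 2); (0, 4); (2, 4); (3, 4); (1, 2); (2, 3)].
Definition three_caps_edges :=
  [:: (0, 1); (0, 2); (4, 6); (5, 6); (2, 4); (1, 2); (2, 3); (3, 4); (4, 5)].

Lemma two_caps_extendable : extendable 5 3 (both_ways two_caps_edges) 2 [:: 2].
Proof. by vm_compute. Qed.

Lemma closed_caps_extendable : extendable 4 3 (both_ways closed_caps_edges) 3 [::].
Proof. by vm_compute. Qed.

Lemma three_caps_extendable : extendable 4 5 (both_ways three_caps_edges) 2 [::].
Proof. by vm_compute. Qed.

Section CapReductions.
Variables (V : finType) (D : nat) (e : rel V).
Hypotheses (e_sym : symmetric e) (deg_le : forall u, deg e u <= D).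
Hypothesis colorable_del : forall P : rel V, symmetric P ->
  (exists u v, e u v && P u v) -> colorable D (del e P).

Lemma colorable_two_caps u s w t x : D = 5 -> two_caps e u s w t x -> colorable D e.
Proof.
move=> D5 /and4P[uniq_vs /and4P[us sw uw /eqP deg_s] /and4P[wt tx wx /eqP deg_t] /eqP deg_w].
apply: (@colorable_configuration _ _ _ e_sym deg_le colorable_del
  u x [:: s; w; t] two_caps_edges 2 [:: 2]) => //=.
- by rewrite us uw sw wt tx wx.
- by rewrite deg_s deg_w deg_t D5.
- by rewrite D5; exact: two_caps_extendable.
Qed.

Lemma colorable_closed_caps u s w t x : D = 4 -> two_caps e u s w t x -> e u x ->
  colorable D e.
Proof.
move=> D4 /and4P[uniq_vs /and4P[us sw uw /eqP deg_s] /and4P[wt tx wx /eqP deg_t] /eqP deg_w] ux.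
apply: (@colorable_configuration _ _ _ e_sym deg_le colorable_del
  u x [:: s; w; t] closed_caps_edges 3 [::]) => //=.
- by rewrite us uw sw wt tx wx ux.
- by rewrite deg_s deg_w deg_t D4.
- by rewrite D4; exact: closed_caps_extendable.
Qed.

Lemma colorable_three_caps u s w t x r y : D = 4 -> three_caps e u s w t x r y ->
  colorable D e.
Proof.
move=> D4 /and4P[uniq_vs two_caps_x /and4P[xr ry xy /eqP deg_r] /eqP deg_x].
case/and4P: two_caps_x => _ /and4P[us sw uw /eqP deg_s] /and4P[wt tx wx /eqP deg_t] /eqP deg_w.
apply: (@colorable_configuration _ _ _ e_sym deg_le colorable_del
  u y [:: s; w; t; x; r] three_caps_edges 2 [::]) => //=.
- by rewrite us uw sw wt tx wx xr ry xy.
- by rewrite deg_s deg_w deg_t deg_x deg_r D4.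
- by rewrite D4; exact: three_caps_extendable.
Qed.

Lemma colorable_two_caps_gt4 u s w t x : 4 < D -> irreflexive e -> two_caps e u s w t x ->
  colorable D e.
Proof.
move=> D_gt4 e_irr two_w; have [D6|D_lt6] := leqP 6 D; last first.
  by apply: colorable_two_caps two_w; apply/eqP; rewrite eqn_leq -ltnS D_lt6.
have /and4P[_ cap_s _ /eqP deg_w] := two_w.
apply: (colorable_cap e_sym e_irr colorable_del _ cap_s); first exact: ltnW.
by move: D6; rewrite deg_w; clear; lia.
Qed.

Lemma colorable_reducible : 3 < D -> irreflexive e -> reducible e -> colorable D e.
Proof.
move=> D_gt3 e_irr.
have cap_reduction := colorable_cap e_sym e_irr colorable_del D_gt3.
case=> [[x [y [xy deg_x deg_y]]]|[u [s [w [cap_s deg_w]]]]|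
  [u [s [w [t [x [two_w ux]]]]]]|[u [s [w [t [x [r [y three_w]]]]]]]].
- exact: (colorable_edge_deg2 e_sym e_irr colorable_del D_gt3 xy deg_x deg_y).
- by apply: cap_reduction cap_s _; rewrite deg_w leq_maxl.
- have [D_gt4|D_le4] := ltnP 4 D; last first.
    by apply: (colorable_closed_caps _ two_w ux); apply/eqP; rewrite eqn_leq D_le4.
  exact: colorable_two_caps_gt4 D_gt4 e_irr two_w.
have [D_gt4|D_le4] := ltnP 4 D; last first.
  by apply: (colorable_three_caps _ three_w); apply/eqP; rewrite eqn_leq D_le4.
by case/and4P: three_w => _ two_w _ _; exact: colorable_two_caps_gt4 D_gt4 e_irr two_w.
Qed.

End CapReductions.

Lemma colorable_edgeless (V : finType) (D : nat) (e : rel V) :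
  1 < D -> (forall u, deg e u = 0) -> colorable D e.
Proof.
move=> D_gt1 deg0; have free_all u : free_out (fun _ _ (_ : 'I_D) => false) u = setT.
  by apply/setP => k; rewrite [RHS]inE; apply/free_outP.
exists (fun _ _ _ => false); split=> [|u v|u].
- by split.
- rewrite [RHS](introF existsP) => [|[//]].
  by apply/negP => uv; have := card0_eq (deg0 u) v; rewrite inE uv.
- by apply: saturated_large; rewrite free_all cardsT card_ord.
Qed.

Theorem even_tournament_colorable (V : finType) (D : nat) (e t : rel V) :
  3 < D -> symmetric e -> irreflexive e -> even_tournament e t ->
  (forall u, deg e u <= D) -> colorable D e.
Proof.
move=> D_gt3; have [n] := ubnP #|[set p : V * V | e p.1 p.2]|.
elim: n e => // n IH e; rewrite ltnS => e_size e_sym e_irr even_t deg_le.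
have colorable_del (P : rel V) : symmetric P -> (exists u v, e u v && P u v) ->
    colorable D (del e P).
  move=> P_sym [u [v /andP[uv Puv]]].
  have del_e : subrel (del e P) e by move=> x y /andP[].
  apply: IH.
  - apply: leq_trans e_size; apply/proper_card/properP; split.
      by apply/subsetP => p; rewrite !inE; exact: del_e.
    by exists (u, v); rewrite !inE /= /del ?uv ?Puv.
  - exact: del_sym.
  - by move=> x; rewrite /del e_irr.
  - by case: even_t => t_anti t_even; split=> // a b c d /del_e ab /del_e; exact: t_even.
  - by move=> x; exact: leq_trans (leq_deg x del_e) (deg_le x).
have [/existsP[v /eqP deg_v]|/existsPn deg_neq1] := boolP [exists v, deg e v == 1].
  have [u] : exists u, u \in [set u | e v u] by apply/card_gt0P; rewrite -/(deg e v) deg_v.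
  rewrite inE e_sym => uv.
  exact: (colorable_leaf e_sym e_irr deg_le colorable_del (ltnW D_gt3) uv deg_v).
have [/existsP deg_gt0|/existsPn deg0] := boolP [exists u, 0 < deg e u].
  apply: colorable_reducible => //.
  exact: even_tournament_reducible even_t deg_gt0 deg_neq1.
by apply: colorable_edgeless (ltnW (ltnW D_gt3)) _ => u; apply/eqP; rewrite -leqn0 leqNgt.
Qed.

(** * Polygonal lines in the plane *)

Import Order.TTheory GRing.Theory Num.Theory.
Import numFieldNormedType.Exports.

Local Open Scope classical_set_scope.
Local Open Scope ring_scope.

Lemma convex_comb_lt (R : realFieldType) (x y c s : R) : s \in `[0, 1] -> x < c -> y < c ->
  (1 - s) * x + s * y < c.
Proof.
rewrite in_itv /= => /andP[s_ge0 s_le1] xc yc.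
have -> : c = (1 - s) * c + s * c by rewrite -mulrDl subrK mul1r.
have [s_gt0|s_le0] := ltrP 0 s.
  by apply: ler_ltD; rewrite ?ltr_pM2l // ler_wpM2l ?subr_ge0 // ltW.
have -> : s = 0 by apply/eqP; rewrite eq_le s_le0.
by rewrite subr0 !mul0r !mul1r !addr0.
Qed.

Section Polylines.
Variables (R : numDomainType) (V : lmodType R).
Implicit Types (a b p : V) (s t : R) (l : seq V).

Definition segpt a b s : V := (1 - s) *: a + s *: b.

Definition segment a b : set V := [set segpt a b s | s in `[0, 1]].

(* The first segment is degenerate, so that every vertex lies on a segment. *)
Definition segs a l : seq (V * V) := pairmap pair a (a :: l).

Definition trace a l : set V := \bigcup_(z in [set` segs a l]) segment z.1 z.2.

Lemma segpt0 a b : segpt a b 0 = a.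
Proof. by rewrite /segpt subr0 scale1r scale0r addr0. Qed.

Lemma segpt1 a b : segpt a b 1 = b.
Proof. by rewrite /segpt subrr scale1r scale0r add0r. Qed.

Lemma segpt_comp a b s t r :
  segpt (segpt a b s) (segpt a b t) r = segpt a b ((1 - r) * s + r * t).
Proof.
rewrite /segpt !scalerDr !scalerA addrACA -!scalerDl; congr (_ *: _ + _ *: _); ring.
Qed.

Lemma segment_l a b : segment a b a.
Proof. by exists 0; rewrite ?segpt0 //= in_itv /= lexx ler01. Qed.

Lemma segment_r a b : segment a b b.
Proof. by exists 1; rewrite ?segpt1 //= in_itv /= lexx ler01. Qed.

Lemma mem_segs a l z : z \in segs a l -> z.1 \in a :: l /\ z.2 \in a :: l.
Proof.
rewrite /segs /= inE => /orP[/eqP->|]; first by rewrite !mem_head.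
elim: l a => [|b l IH] a //=; rewrite inE => /orP[/eqP->|/IH[z1 z2]].
  by rewrite !inE !eqxx orbT.
by rewrite !(in_cons a) z1 z2 !orbT.
Qed.

Lemma trace_vertex a l p : p \in a :: l -> trace a l p.
Proof.
suff vertex_seg : p \in a :: l -> exists2 z, z \in segs a l & z.2 = p.
  by case/vertex_seg=> z zl <-; exists z => //; exact: segment_r.
rewrite /segs /= inE => /orP[/eqP->|]; first by exists (a, a); rewrite ?mem_head.
move=> pl; suff [z zl zp] : exists2 z, z \in pairmap pair a l & z.2 = p.
  by exists z; rewrite // inE zl orbT.
elim: l a pl => [|b l IH] a //; rewrite inE => /orP[/eqP->|/(IH b)[z zl zp]].
  by exists (a, b); rewrite //= mem_head.
by exists z; rewrite //= inE zl orbT.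
Qed.

Lemma trace_segment a l z : z \in segs a l -> segment z.1 z.2 `<=` trace a l.
Proof. by move=> zl p zp; exists z. Qed.

Lemma segment_refl a : segment a a = [set a].
Proof.
apply/seteqP; split=> [_ [s _ <-]|_ ->]; last exact: segment_l.
by rewrite /= /segpt -scalerDl subrK scale1r.
Qed.

Lemma trace_nil a : trace a [::] = [set a].
Proof.
rewrite -segment_refl; apply/seteqP; split=> [p [z]|p pa].
  by rewrite /mkset inE => /eqP->.
by exists (a, a); rewrite // /mkset mem_head.
Qed.

Lemma trace_cons a b l : trace a (b :: l) `<=` segment a b `|` trace b l.
Proof.
move=> p [z]; rewrite /segs /mkset /= !inE => /or3P[/eqP->|/eqP->|zl] pz; [left|by left|right].
  by move: pz; rewrite /= segment_refl => ->; exact: segment_l.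
by exists z; rewrite // /mkset inE zl orbT.
Qed.

Lemma trace_rcons a l b : trace a (rcons l b) = trace a l `|` segment (last a l) b.
Proof.
have segsE : segs a (rcons l b) = rcons (segs a l) (last a l, b).
  by rewrite /segs -rcons_cons -cats1 pairmap_cat cats1.
rewrite /trace segsE; apply/seteqP; split=> [p [z]|p [[z zl zp]|pb]].
- rewrite /mkset mem_rcons inE => /orP[/eqP-> /=|zl zp]; [by right | by left; exists z].
- by exists z; rewrite // /mkset mem_rcons inE; apply/orP; right.
- by exists (last a l, b); rewrite // /mkset mem_rcons mem_head.
Qed.

Lemma telescope_segs (g : V -> bool) a l :
  \big[addb/false]_(z <- segs a l) (g z.1 (+) g z.2) = g a (+) g (last a l).
Proof.
rewrite /segs /= big_cons /= addbb addFb.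
elim: l a => [|b l IH] a /=; first by rewrite big_nil addbb.
by rewrite big_cons IH /= addbA addbK.
Qed.

Definition joins a l p q := (a = p /\ last a l = q) \/ (a = q /\ last a l = p).

Lemma joins_addb (g : V -> bool) a l p q : joins a l p q ->
  g a (+) g (last a l) = g p (+) g q.
Proof. by case=> [[-> ->]|[-> ->]] //; rewrite addbC. Qed.

End Polylines.

Section Shear.
Variable R : realFieldType.
Local Notation point := (R * R)%type.
Implicit Types (a b c d p q : point) (s t : R) (l m : seq point).

Lemma segptE a b s : segpt a b s = ((1 - s) * a.1 + s * b.1, (1 - s) * a.2 + s * b.2).
Proof. by []. Qed.

(* After the shear [absc] the vertical direction is generic, so that finitely many
   distinct points have distinct abscissas. *)
Variable tau : R.
Definition absc p := p.1 + tau * p.2.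

Lemma absc_segpt a b s : absc (segpt a b s) = (1 - s) * absc a + s * absc b.
Proof. by rewrite /absc segptE /=; ring. Qed.

Lemma point_eq p q : absc p = absc q -> p.2 = q.2 -> p = q.
Proof.
move=> abs_eq eq2; rewrite (surjective_pairing p) (surjective_pairing q) eq2; congr pair.
by move: abs_eq; rewrite /absc eq2; exact: addIr.
Qed.

Definition between a b c := (absc a < absc c) (+) (absc b < absc c).

Definition orient a b c :=
  (absc b - absc a) * (c.2 - a.2) - (b.2 - a.2) * (absc c - absc a).

Definition above a b c := between a b c && (0 < (absc a - absc b) * orient a b c).
Definition below a b c := between a b c && (0 < (absc b - absc a) * orient a b c).

Lemma disjoint_segments_height a b c d s t s' t' : segment a b `<=` ~` segment c d ->
  s \in `[0, 1] -> t \in `[0, 1] -> s' \in `[0, 1] -> t' \in `[0, 1] ->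
  absc (segpt a b s) = absc (segpt c d t) -> absc (segpt a b s') = absc (segpt c d t') ->
  (segpt c d t).2 < (segpt a b s).2 -> (segpt c d t').2 < (segpt a b s').2.
Proof.
move=> dis s01 t01 s'01 t'01 Pabs Qabs P'_lt; rewrite ltNge; apply/negP => Q_le.
set P : point := segpt a b s in Pabs P'_lt; set P' : point := segpt c d t in Pabs P'_lt.
set Q : point := segpt a b s' in Qabs Q_le; set Q' : point := segpt c d t' in Qabs Q_le.
pose gap : R := (P.2 - P'.2) + (Q'.2 - Q.2).
have gap_gt0 : 0 < gap by rewrite /gap; lra.
pose r : R := (P.2 - P'.2) / gap.
have r_ge0 : 0 <= r by rewrite /r divr_ge0 //; lra.
have r_le1 : r <= 1 by rewrite /r ler_pdivrMr // mul1r /gap; lra.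
have r_gap : r * gap = P.2 - P'.2 by rewrite /r divfK // gt_eqF.
have cross : segpt P Q r = segpt P' Q' r.
  apply: point_eq; first by rewrite (absc_segpt P) (absc_segpt P') Pabs Qabs.
  have meet_at (x x' y y' : R) : r * (x - x' + (y' - y)) = x - x' ->
      (1 - r) * x + r * y = (1 - r) * x' + r * y' by lra.
  exact: meet_at r_gap.
have convex x y : x \in `[0, 1] -> y \in `[0, 1] -> (1 - r) * x + r * y \in `[0, 1].
  by rewrite !in_itv /= => /andP[x0 x1] /andP[y0 y1]; apply/andP; split; nra.
apply: (dis (segpt P Q r)); last rewrite cross.
  by rewrite segpt_comp; exists ((1 - r) * s + r * s') => //=; exact: convex.
by rewrite segpt_comp; exists ((1 - r) * t + r * t') => //=; exact: convex.
Qed.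

Lemma betweenP a b c : absc a != absc c -> absc b != absc c -> between a b c ->
  exists2 s : R, s \in `[0, 1] & [/\ absc (segpt a b s) = absc c,
    above a b c = (c.2 < (segpt a b s).2) & below a b c = ((segpt a b s).2 < c.2)].
Proof.
move=> ac bc btw.
have ab : absc b - absc a != 0.
  by rewrite subr_eq0; apply: contraTneq btw => ab; rewrite /between ab addbb.
pose s : R := (absc c - absc a) / (absc b - absc a).
have s_eq : s * (absc b - absc a) = absc c - absc a by rewrite /s divfK.
have s_abs : absc (segpt a b s) = absc c by rewrite absc_segpt; lra.
have s01 : s \in `[0, 1].
  rewrite in_itv /=; move: btw; rewrite /between.
  have [ac_lt|ca_lt|ac_eq] := ltgtP (absc a) (absc c); last by rewrite ac_eq eqxx in ac.
    have [//|cb_lt|bc_eq] := ltgtP (absc b) (absc c); last by rewrite bc_eq eqxx in bc.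
    by move=> _; rewrite /s divr_ge0 ?ler_pdivrMr; lra.
  have [bc_lt|//|bc_eq] := ltgtP (absc b) (absc c); last by rewrite bc_eq eqxx in bc.
  by move=> _; rewrite /s -divrNN divr_ge0 ?ler_pdivrMr; lra.
exists s => //; split=> //.
- have -> : above a b c = (0 < (absc b - absc a) ^+ 2 * ((segpt a b s).2 - c.2)).
    by rewrite segptE /above btw /orient -s_eq /=; congr (_ < _); ring.
  by rewrite pmulr_rgt0 ?subr_gt0 // exprn_even_gt0.
- have -> : below a b c = (0 < (absc b - absc a) ^+ 2 * (c.2 - (segpt a b s).2)).
    by rewrite segptE /below btw /orient -s_eq /=; congr (_ < _); ring.
  by rewrite pmulr_rgt0 ?subr_gt0 // exprn_even_gt0.
Qed.

Lemma above_addb_below a b c : absc a != absc c -> absc b != absc c -> ~ segment a b c ->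
  above a b c (+) below a b c = between a b c.
Proof.
move=> ac bc not_ab; have [btw|not_btw] := boolP (between a b c); last first.
  by rewrite /above /below (negbTE not_btw).
have [s s01 [s_abs -> ->]] := betweenP ac bc btw.
have [//|//|eq2] := ltgtP c.2 (segpt a b s).2.
by case: not_ab; exists s => //; apply: point_eq.
Qed.

Lemma disjoint_segments_even a b c d : segment a b `<=` ~` segment c d ->
  absc a != absc c -> absc a != absc d -> absc b != absc c -> absc b != absc d ->
  above a b c (+) above a b d (+) (below c d a (+) below c d b) = false.
Proof.
move=> dis ac ad bc bd.
pose higher := `[< exists s t : R, [/\ s \in `[0, 1], t \in `[0, 1],
  absc (segpt a b s) = absc (segpt c d t) & (segpt c d t).2 < (segpt a b s).2] >].
have higherE s t : s \in `[0, 1] -> t \in `[0, 1] ->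
    absc (segpt a b s) = absc (segpt c d t) -> ((segpt c d t).2 < (segpt a b s).2) = higher.
  move=> s01 t01 st; apply/idP/idP => [st_lt|]; first by apply/asboolP; exists s, t.
  case/asboolP => s' [t' [s'01 t'01 s't' lt_s't']].
  exact: (disjoint_segments_height dis s'01 t'01 s01 t01 s't' st lt_s't').
have aboveE t : t \in `[0, 1] -> absc a != absc (segpt c d t) -> absc b != absc (segpt c d t) ->
    above a b (segpt c d t) = between a b (segpt c d t) && higher.
  move=> t01 at_neq bt_neq; have [btw|not_btw] := boolP (between a b _); last first.
    by rewrite /above (negbTE not_btw).
  by have [s s01 [s_abs -> _]] := betweenP at_neq bt_neq btw; exact: higherE.
have belowE s : s \in `[0, 1] -> absc c != absc (segpt a b s) -> absc d != absc (segpt a b s) ->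
    below c d (segpt a b s) = between c d (segpt a b s) && higher.
  move=> s01 cs_neq ds_neq; have [btw|not_btw] := boolP (between c d _); last first.
    by rewrite /below (negbTE not_btw).
  by have [t t01 [t_abs _ ->]] := betweenP cs_neq ds_neq btw; exact: higherE.
have [zero01 one01] : 0 \in `[0 : R, 1] /\ 1 \in `[0 : R, 1] by rewrite !in_itv /= !lexx ler01.
have := aboveE 0 zero01; have := aboveE 1 one01; have := belowE 0 zero01; have := belowE 1 one01.
rewrite !segpt0 !segpt1 !(eq_sym (absc c)) !(eq_sym (absc d)).
move=> -> // -> // -> // -> //; rewrite -!andb_addl /between.
have flip p q : absc p != absc q -> (absc p < absc q) = ~~ (absc q < absc p).
  by move=> pq; rewrite ltNge le_eqVlt negb_or eq_sym pq.
rewrite (flip a c) // (flip a d) // (flip b c) // (flip b d) //.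
by do !case: (_ < _).
Qed.

Definition above_parity a l c := \big[addb/false]_(z <- segs a l) above z.1 z.2 c.
Definition below_parity a l c := \big[addb/false]_(z <- segs a l) below z.1 z.2 c.

Lemma disjoint_polylines_even a l c m : trace a l `<=` ~` trace c m ->
  (forall p q, p \in a :: l -> q \in c :: m -> absc p != absc q) ->
  above_parity a l c (+) above_parity a l (last c m) (+)
    (below_parity c m a (+) below_parity c m (last a l)) = false.
Proof.
move=> dis absc_neq; rewrite /above_parity /below_parity -!big_split /=.
under eq_bigr => z _ do rewrite -telescope_segs.
under [X in _ (+) X]eq_bigr => z _ do rewrite -telescope_segs.
rewrite [X in _ (+) X]exchange_big -big_split /= big_seq; apply: big1 => z zl.
rewrite -big_split /= big_seq; apply: big1 => z' zm.
have [z1 z2] := mem_segs zl; have [z1' z2'] := mem_segs zm.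
apply: disjoint_segments_even; try exact: absc_neq.
by move=> p /(trace_segment zl)/dis not_p /(trace_segment zm).
Qed.

Lemma above_parity_addb_below_parity a l c : ~ trace a l c ->
  (forall p, p \in a :: l -> absc p != absc c) ->
  above_parity a l c (+) below_parity a l c = (absc a < absc c) (+) (absc (last a l) < absc c).
Proof.
move=> not_c absc_neq; rewrite /above_parity /below_parity -big_split /=.
rewrite -(telescope_segs (fun p => absc p < absc c)) big_seq [RHS]big_seq.
apply: eq_bigr => z zl; have [z1 z2] := mem_segs zl.
apply: above_addb_below; try exact: absc_neq.
by move=> /(trace_segment zl).
Qed.

(* A point beyond the line [al * x + be * y = const] sees either no segment
   above it, or all of those that are vertically aligned with it. *)
Lemma above_parity_far a l q al be :
  (forall p, p \in a :: l -> al * p.1 + be * p.2 < al * q.1 + be * q.2) ->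
  (forall p, p \in a :: l -> absc p != absc q) ->
  above_parity a l q = (be < al * tau) && ((absc a < absc q) (+) (absc (last a l) < absc q)).
Proof.
move=> far absc_neq; rewrite /above_parity.
rewrite -(telescope_segs (fun p => absc p < absc q)) big_distrr /= big_seq [RHS]big_seq.
apply: eq_bigr => z zl; have [z1 z2] := mem_segs zl.
have [btw|not_btw] := boolP (between z.1 z.2 q); last first.
  by rewrite /above -/(between _ _ _) (negbTE not_btw) andbF.
have [s s01 [s_abs -> _]] := betweenP (absc_neq _ z1) (absc_neq _ z2) btw.
rewrite -/(between _ _ _) btw andbT; set w : point := segpt z.1 z.2 s in s_abs *.
have [w1 w2] : w.1 = (1 - s) * z.1.1 + s * z.2.1 /\ w.2 = (1 - s) * z.1.2 + s * z.2.2 by [].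
have w_far : al * w.1 + be * w.2 < al * q.1 + be * q.2.
  have far1 := far _ z1; have far2 := far _ z2; rewrite w1 w2.
  have -> : forall x x' y y', al * ((1 - s) * x + s * x') + be * ((1 - s) * y + s * y') =
      (1 - s) * (al * x + be * y) + s * (al * x' + be * y') by move=> *; ring.
  exact: convex_comb_lt.
have side_w : (be - al * tau) * (w.2 - q.2) < 0 by move: s_abs w_far; rewrite /absc; nra.
by apply/idP/idP => lt_q; nra.
Qed.

End Shear.

Lemma exists_strict_ub (R : realDomainType) (s : seq R) : exists M, forall x, x \in s -> x < M.
Proof.
elim: s => [|y s [M M_ub]]; first by exists 0.
exists (Num.max M (y + 1)) => x; rewrite inE lt_max => /orP[/eqP->|/M_ub-> //].
by rewrite ltrDl ltr01 orbT.
Qed.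

Lemma generic_shear (R : realFieldType) (S : seq (R * R)) :
  exists tau, {in S &, forall p q, p <> q -> absc tau p != absc tau q}.
Proof.
pose slope (p q : R * R) := (q.1 - p.1) / (p.2 - q.2).
have [M M_ub] := exists_strict_ub [seq slope p q | p <- S, q <- S].
exists M => p q pS qS pq; apply/eqP => abs_eq; apply: pq.
apply: (point_eq abs_eq); apply/eqP; apply: contraT => neq2.
have := M_ub _ (allpairs_f slope pS qS); rewrite /slope.
have -> : q.1 - p.1 = M * (p.2 - q.2) by move: abs_eq; rewrite /absc; lra.
by rewrite mulfK ?ltxx // subr_eq0.
Qed.

Section PolygonalDrawing.
Variables (R : realFieldType) (V : finType) (e : rel V).
Variables (pos : V -> R * R) (start : V -> V -> R * R) (edge : V -> V -> seq (R * R)).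
Variables (ray : V -> seq (R * R)) (al be : V -> R).
Let far v := last (pos v) (ray v).
Hypothesis pos_inj : injective pos.
Hypothesis edge_joins : forall u v, e u v -> joins (start u v) (edge u v) (pos u) (pos v).
Hypothesis edge_disjoint : forall a b c d, e a b -> e c d ->
  [disjoint [:: a; b] & [:: c; d]]%B ->
  trace (start a b) (edge a b) `<=` ~` trace (start c d) (edge c d).
Hypothesis ray_disjoint : forall u w v, e u w -> v \notin [:: u; w] ->
  trace (start u w) (edge u w) `<=` ~` trace (pos v) (ray v).
Hypothesis ray_far : forall v u w p, e u w -> p \in start u w :: edge u w ->
  al v * p.1 + be v * p.2 < al v * (far v).1 + be v * (far v).2.

Definition drawing_vertices : seq (R * R) :=
  flatten [seq start uv.1 uv.2 :: edge uv.1 uv.2 | uv <- enum {: V * V}] ++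
  flatten [seq pos v :: ray v | v <- enum V].

Lemma edge_drawing_vertices u v : {subset start u v :: edge u v <= drawing_vertices}.
Proof.
move=> p p_uv; rewrite mem_cat; apply/orP; left; apply/flattenP.
exists (start u v :: edge u v) => //; apply/mapP; exists (u, v) => //.
by rewrite mem_enum.
Qed.

Lemma ray_drawing_vertices v : {subset pos v :: ray v <= drawing_vertices}.
Proof.
move=> p p_v; rewrite mem_cat; apply/orP; right; apply/flattenP.
by exists (pos v :: ray v) => //; apply/mapP; exists v; rewrite ?mem_enum.
Qed.

Section GenericShear.
Variable tau : R.
Hypothesis tau_generic :
  {in drawing_vertices &, forall p q, p <> q -> absc tau p != absc tau q}.

Let x v := absc tau (pos v).

Definition ray_parity v u :=
  below_parity tau (pos v) (ray v) (pos u) (+) (be v < al v * tau) && (x u < absc tau (far v)).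

Lemma absc_edge_ray u w v p q : e u w -> v \notin [:: u; w] ->
  p \in start u w :: edge u w -> q \in pos v :: ray v -> absc tau p != absc tau q.
Proof.
move=> uw v_uw p_uw q_v; apply: tau_generic.
- exact: edge_drawing_vertices p_uw.
- exact: ray_drawing_vertices q_v.
move=> pq; apply: (ray_disjoint uw v_uw (trace_vertex p_uw)).
by rewrite pq; exact: trace_vertex.
Qed.

Lemma above_parity_edge u w v : e u w -> v \notin [:: u; w] ->
  above_parity tau (start u w) (edge u w) (pos v) = ray_parity v u (+) ray_parity v w.
Proof.
move=> uw v_uw; have absc_neq := absc_edge_ray uw v_uw.
have := disjoint_polylines_even (ray_disjoint uw v_uw) absc_neq.
rewrite (above_parity_far (q := last _ _) (al := al v) (be := be v)); last 2 first.
- by move=> p; exact: ray_far.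
- by move=> p p_uw; apply: absc_neq; rewrite // mem_last.
rewrite (joins_addb (below_parity tau (pos v) (ray v)) (edge_joins uw)).
rewrite (joins_addb (fun p => absc tau p < absc tau (far v)) (edge_joins uw)) andb_addr.
rewrite /ray_parity /x addbACA -addbA => /eqP; rewrite eqbF_neg negb_add => /eqP ->.
by rewrite [RHS](AC (2*2) (1*((2*4)*3))).
Qed.

Lemma below_parity_edge u w v : e u w -> v \notin [:: u; w] ->
  below_parity tau (start u w) (edge u w) (pos v) =
  ray_parity v u (+) ray_parity v w (+) ((x u < x v) (+) (x w < x v)).
Proof.
move=> uw v_uw; rewrite -above_parity_edge //.
rewrite -(joins_addb (fun p => absc tau p < x v) (edge_joins uw)).
rewrite -above_parity_addb_below_parity ?addKb // => [v_trace|p p_uw].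
  by apply: (ray_disjoint uw v_uw v_trace); apply: trace_vertex; rewrite mem_head.
by apply: (absc_edge_ray uw v_uw p_uw); rewrite mem_head.
Qed.

Definition ray_order u w := ray_parity w u (+) ray_parity u w (+) (x w < x u).

Lemma ray_order_even_tournament : even_tournament e ray_order.
Proof.
split=> [u v uv|a b c d ab cd dis].
  have pos_vertex w : pos w \in drawing_vertices.
    by apply: (ray_drawing_vertices (v := w)); rewrite mem_head.
  have : x u != x v.
    by apply: tau_generic => // /pos_inj /eqP; rewrite (negbTE uv).
  rewrite /ray_order (addbC (ray_parity v u)).
  by case: ltgtP; rewrite // ?addbF ?addbT ?negbK.
have notin_cd v : v \in [:: a; b] -> v \notin [:: c; d] by move=> /(disjointFr dis)->.
have notin_ab v : v \in [:: c; d] -> v \notin [:: a; b] by move=> /(disjointFl dis)->.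
have dis_trace := edge_disjoint ab cd dis.
have absc_neq p q : p \in start a b :: edge a b -> q \in start c d :: edge c d ->
    absc tau p != absc tau q.
  move=> p_ab q_cd; apply: tau_generic => [||pq].
  - exact: edge_drawing_vertices p_ab.
  - exact: edge_drawing_vertices q_cd.
  - by apply: (dis_trace _ (trace_vertex p_ab)); rewrite pq; exact: trace_vertex.
have := disjoint_polylines_even dis_trace absc_neq.
rewrite (joins_addb (above_parity _ _ _) (edge_joins cd)).
rewrite (joins_addb (below_parity _ _ _) (edge_joins ab)).
rewrite !above_parity_edge ?below_parity_edge ?notin_cd ?notin_ab ?inE ?eqxx ?orbT // => even.
rewrite -even /interleave /ray_order.
rewrite [LHS](AC ((3*3)*(3*3)) (((1*7)*(4*10))*(((2*5)*(3*6))*((8*11)*(9*12))))) //.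
Qed.

End GenericShear.

Lemma polygonal_even_tournament : exists t, even_tournament e t.
Proof.
have [tau tau_generic] := generic_shear drawing_vertices.
by exists (ray_order tau); exact: ray_order_even_tournament.
Qed.

End PolygonalDrawing.

(** * From outerplanar drawings to even tournaments *)

Section NormedSpace.
Variables (R : realType) (V : normedModType R).
Implicit Types (A B : set V) (p x : V) (l : seq V).

Definition thickening A (delta : R) := [set p | exists2 q, A q & `|q - p| < delta].

Lemma sub_thickening A delta : 0 < delta -> A `<=` thickening A delta.
Proof. by move=> delta_gt0 p Ap; exists p; rewrite // subrr normr0. Qed.

Lemma disjoint_thickenings A B : compact A -> compact B -> A `<=` ~` B ->
  exists2 delta : R, 0 < delta & thickening A delta `<=` ~` thickening B delta.
Proof.
move=> cA cB dis; pose diff (z : V * V) : V := z.1 - z.2.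
have diff_cont : continuous diff.
  by move=> z; apply: cvgB; [exact: cvg_fst | exact: cvg_snd].
have cAB : compact (diff @` (A `*` B)).
  apply: continuous_compact; last exact: compact_setX.
  exact: continuous_subspaceT.
have closedAB := compact_closed (@norm_hausdorff _ _) cAB.
have /nbhs_normP[eps /= eps_gt0 eps_sep] : nbhs (0 : V) (~` (diff @` (A `*` B))).
  apply: open_nbhs_nbhs; split; first exact: closed_openC.
  by move=> [[a b] [Aa Bb]] /eqP; rewrite subr_eq0 => /eqP /= ab; apply: (dis a Aa); rewrite ab.
exists (eps / 2) => [|p [a Aa ap] [b Bb bp]]; first by rewrite divr_gt0.
apply: (eps_sep (a - b)); last by exists (a, b).
rewrite /ball_ /= sub0r normrN; apply: le_lt_trans (ler_distD p a b) _.
by rewrite (distrC p) [ltRHS](splitr eps) ltrD.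
Qed.

Lemma segpt_continuous (a b : V) : continuous (segpt a b).
Proof.
move=> s; apply: cvgD; apply: cvgZr_tmp; last exact: cvg_id.
by apply: cvgB; [exact: cvg_cst | exact: cvg_id].
Qed.

Lemma trace_compact a l : compact (trace a l).
Proof.
rewrite /trace classical_sets.bigcup_seq; apply: bigsetU_compact => z _.
apply: continuous_compact; last exact: segment_compact.
exact/continuous_subspaceT/segpt_continuous.
Qed.

Lemma segment_ball (c : V) (r : R) (a b : V) :
  ball c r a -> ball c r b -> segment a b `<=` ball c r.
Proof.
rewrite -ball_normE /= => ca cb _ [s /= s01 <-].
have -> : c - segpt a b s = (1 - s) *: (c - a) + s *: (c - b).
  by rewrite /segpt !scalerBr addrACA -scalerDl subrK scale1r opprD.
have /andP[s_ge0 s_le1] : 0 <= s <= 1 by move: s01; rewrite in_itv.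
apply: le_lt_trans (ler_normD _ _) _; rewrite !normrZ !ger0_norm ?subr_ge0 //.
exact: convex_comb_lt.
Qed.

Definition polygonally_joined (U : set V) p x := exists2 l, last p l = x & trace p l `<=` U.

Lemma polygonally_joined_segment U p x y : polygonally_joined U p x -> segment x y `<=` U ->
  polygonally_joined U p y.
Proof.
case=> l lx l_U xy_U; exists (rcons l y); first by rewrite last_rcons.
by rewrite trace_rcons lx => q []; [exact: l_U | exact: xy_U].
Qed.

Lemma polygonally_joined_in U p x : polygonally_joined U p x -> U x.
Proof. by case=> l <-; apply; apply: trace_vertex; exact: mem_last. Qed.

(* The points joined to [p] by a polygonal line inside an open set [U] form a
   relatively clopen subset of [U]. *)
Lemma connected_polygonally_joined (U : set V) p x : open U ->
  connected_component U p x -> polygonally_joined U p x.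
Proof.
move=> openU [S [Sp SU connS] Sx].
have ball_in y : U y -> exists2 r : R, 0 < r & ball y r `<=` U.
  move=> Uy; have /nbhs_ballP[r r_gt0 ball_U] : nbhs y U by apply: open_nbhs_nbhs.
  by exists r.
have near_joined y : U y -> \forall q \near y,
    (polygonally_joined U p q <-> polygonally_joined U p y).
  move=> /ball_in[r r_gt0 ball_U]; apply/nbhs_ballP; exists r => // q yq.
  have yy : ball y r y by exact: ballxx.
  split=> joined; apply: (polygonally_joined_segment joined) => z.
    by move=> /(segment_ball yq yy)/ball_U.
  by move=> /(segment_ball yy yq)/ball_U.
pose J := [set y | polygonally_joined U p y].
have openJ : open J.
  rewrite openE => y Jy; have Uy := polygonally_joined_in Jy.
  by apply: filterS (near_joined y Uy) => q [_]; exact.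
have openUJ : open (U `\` J).
  rewrite openE => y [Uy nJy]; have near_U : \forall q \near y, U q by exact: open_nbhs_nbhs.
  by apply: filterS2 near_U (near_joined y Uy) => q Uq [qy _]; split=> // /qy.
have SJ : S `&` J = S.
  apply: connS.
  - exists p; split=> //; exists [::] => //.
    by rewrite trace_nil => _ ->; exact: SU.
  - by exists J.
  exists (~` (U `\` J)); first exact: open_closedC.
  apply/seteqP; split=> y [Sy]; first by move=> Jy; split=> // -[].
  by move=> not_UJ; split=> //; apply: contrapT => nJy; apply: not_UJ; split=> //; exact: SU.
by move: Sx; rewrite -SJ => -[].
Qed.

Lemma unbounded_far (C : set V) (M : R) : ~ bounded_set C -> exists2 x, C x & M < `|x|.
Proof.
move=> unbounded; apply: contrapT => not_far; apply: unbounded.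
exists M; split=> [|M' MM' x Cx]; first exact: num_real.
by rewrite /= leNgt; apply/negP => M'x; apply: not_far; exists x; rewrite ?(lt_trans MM').
Qed.

Lemma compact_uniformly_continuous (U : normedModType R) (K : set U) (g : U -> V) (eps : R) :
  compact K -> {within K, continuous g} -> 0 < eps ->
  \forall eta \near 0^'+, {in K &, forall s t, `|s - t| < eta -> `|g s - g t| < eps}.
Proof.
move=> /compact_near_coveringP covering /subspace_continuousP g_cont eps_gt0.
have eps2_gt0 : 0 < eps / 2 by rewrite divr_gt0.
have covered : \forall eta \near 0^'+, K `<=` (fun s => K s -> forall t, K t ->
    `|s - t| < eta -> `|g s - g t| < eps).
  apply: covering => x Kx.
  have /cvgrPdist_lt/(_ _ eps2_gt0)/nbhs_normP[r /= r_gt0 near_x] := g_cont x Kx.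
  have r2_gt0 : 0 < r / 2 by rewrite divr_gt0.
  exists (ball x (r / 2), [set eta | eta < r / 2]) => /=.
    by split; [exact: nbhsx_ballx | exact: nbhs_right_lt].
  case=> s eta /= []; rewrite -ball_normE /= => xs eta_lt Ks t Kt st.
  have gs : `|g s - g x| < eps / 2 by rewrite distrC; apply: near_x => //=; lra.
  have gt : `|g x - g t| < eps / 2.
    by apply: near_x => //=; have := ler_distD s x t; lra.
  by have := ler_distD (g x) (g s) (g t); lra.
by apply: filterS covered => eta covered s t /set_mem Ks /set_mem Kt; exact: covered.
Qed.

End NormedSpace.

Section Polygon.
Variables (R : realType) (V : normedModType R) (g : R -> V).
Hypothesis g_cont : {within `[0, 1], continuous g}.

Definition polygon (N : nat) : seq V := [seq g (k%:R / N%:R) | k <- iota 1 N].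

Lemma natr_div_itv k N : (k <= N)%N -> (k%:R / N%:R : R) \in `[0, 1].
Proof.
move=> kN; rewrite in_itv /= divr_ge0 ?ler0n //=; have [->|N_gt0] := posnP N.
  by rewrite invr0 mulr0 ler01.
by rewrite ler_pdivrMr ?ltr0n // mul1r ler_nat.
Qed.

Lemma mem_polygon N p : p \in g 0 :: polygon N -> exists2 s : R, s \in `[0, 1] & p = g s.
Proof.
rewrite inE => /orP[/eqP->|/mapP[k]]; first by exists 0; rewrite // in_itv /= lexx ler01.
by rewrite mem_iota => /andP[_ kN] ->; exists (k%:R / N%:R) => //; exact: natr_div_itv.
Qed.

Lemma last_polygon N : (0 < N)%N -> last (g 0) (polygon N) = g 1.
Proof.
case: N => // N _; rewrite /polygon -addn1 iotaD map_cat last_cat /= add1n addn1.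
by rewrite divff // pnatr_eq0.
Qed.

Lemma segs_polygon N z : z \in segs (g 0) (polygon N) ->
  exists s t : R, [/\ s \in `[0, 1], t \in `[0, 1], `|s - t| <= N%:R^-1 & z = (g s, g t)].
Proof.
rewrite /segs /= inE => /orP[/eqP->|].
  by exists 0, 0; rewrite in_itv /= lexx ler01 subrr normr0 invr_ge0 ler0n.
have segs_from m n : (m + n <= N)%N ->
    z \in pairmap pair (g (m%:R / N%:R)) [seq g (k%:R / N%:R) | k <- iota m.+1 n] ->
    exists s t : R, [/\ s \in `[0, 1], t \in `[0, 1], `|s - t| <= N%:R^-1 & z = (g s, g t)].
  elim: n m => // n IH m; rewrite addnS => mnN; rewrite inE => /orP[/eqP->|]; last exact: IH.
  exists (m%:R / N%:R), (m.+1%:R / N%:R).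
  have mN : (m < N)%N by apply: leq_trans mnN; rewrite ltnS leq_addr.
  rewrite !natr_div_itv ?(ltnW mN) // distrC -mulrBl -natrB // subSnn mul1r.
  by rewrite ger0_norm ?invr_ge0 ?ler0n.
by rewrite -[X in g X](mul0r N%:R^-1); exact: (segs_from 0%N N).
Qed.

Lemma trace_polygon_thickening (delta : R) : 0 < delta ->
  \forall N \near \oo, trace (g 0) (polygon N) `<=` thickening (g @` `[0, 1]) delta.
Proof.
move=> delta_gt0.
have near_eta := compact_uniformly_continuous (@segment_compact R 0 1) g_cont delta_gt0.
have [eta [eta_gt0 g_eta]] := filter_ex (filterI (nbhs_right_gt 0) near_eta).
have near_N : \forall N \near \oo, eta^-1 < N%:R by exact: nbhs_infty_gtr.
apply: filterS near_N => N N_gt p [z /segs_polygon[s [t [s01 t01 st ->]]] p_st].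
have N_gt0 : 0 < (N%:R : R) by apply: lt_trans N_gt; rewrite invr_gt0.
exists (g s); first by exists s.
have := segment_ball _ _ p_st; rewrite -ball_normE; apply.
  by rewrite /ball_ /= subrr normr0.
apply: g_eta; [exact: mem_set | exact: mem_set | apply: le_lt_trans st _].
by rewrite -(invrK eta) ltf_pV2 // posrE invr_gt0.
Qed.

End Polygon.

Lemma exists_separating_functional (R : realType) (M : R) (q : R * R) : M < `|q| ->
  exists al be : R, forall p : R * R, `|p| <= M -> al * p.1 + be * p.2 < al * q.1 + be * q.2.
Proof.
have sg_lt (x y : R) : `|x| <= M -> M < `|y| -> Num.sg y * x < Num.sg y * y.
  move=> xM My; rewrite -normrEsg; apply: le_lt_trans My; apply: le_trans xM.
  apply: le_trans (ler_norm _) _; rewrite normrM normr_sg.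
  by case: (y != 0); rewrite ?mul1r // mul0r.
rewrite prod_normE lt_max => /orP[] q_far; [exists (Num.sg q.1), 0 | exists 0, (Num.sg q.2)] => p;
  rewrite prod_normE ge_max => /andP[p1 p2]; rewrite !mul0r ?addr0 ?add0r; exact: sg_lt.
Qed.

Section Drawing.
Variables (R : realType) (G : sgraph).
Variables (pos : G -> R * R) (arc : {set G} -> R -> R * R).
Hypothesis emb : plane_embedding pos arc.
Implicit Types (u v : G) (e f : {set G}).

Definition arc_image e := arc e @` `[0, 1].

Lemma mem_edges u v : adj u v -> [set u; v]%SET \in edges G.
Proof. by move=> uv; apply/imsetP; exists (u, v); rewrite ?inE. Qed.

Lemma edge_nonempty e : e \in edges G -> exists u, u \in e.
Proof. by case/imsetP=> -[u v] _ ->; exists u; rewrite !inE eqxx. Qed.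

Lemma pos_injective : injective pos.
Proof. by case: emb. Qed.

Lemma arc_continuous e : e \in edges G -> {within `[0, 1], continuous (arc e)}.
Proof. by case: emb => _ arc_inj _ _ _ /arc_inj[]. Qed.

Lemma arc_image_compact e : e \in edges G -> compact (arc_image e).
Proof.
by move=> e_edge; apply: continuous_compact (arc_continuous e_edge) (@segment_compact R 0 1).
Qed.

Lemma arc_imageP e p : e \in edges G -> arc_image e p ->
  (exists2 u, u \in e & p = pos u) \/ (exists2 t : R, t \in `]0, 1[ & p = arc e t).
Proof.
move=> e_edge [t /= t01 <-]; case: emb => _ _ ends _ _.
have is_end s : [set arc e 0; arc e 1] (arc e s) -> exists2 u, u \in e & arc e s = pos u.
  by rewrite (ends e e_edge) => -[u /= ue <-]; exists u.
have [->|t_neq0] := eqVneq t 0; first by left; apply: is_end; left.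
have [->|t_neq1] := eqVneq t 1; first by left; apply: is_end; right.
right; exists t => //; move: t01; rewrite !in_itv /= => /andP[t_ge0 t_le1].
by rewrite !lt_neqAle t_ge0 t_le1 eq_sym t_neq0 t_neq1.
Qed.

Lemma arc_image_pos e v : e \in edges G -> v \notin e -> ~ arc_image e (pos v).
Proof.
move=> e_edge ve /(arc_imageP e_edge)[[u ue /pos_injective vu]|[t t01 vt]].
  by rewrite vu ue in ve.
by case: emb => _ _ _ off_vertices _; exact: (off_vertices e e_edge v t).
Qed.

Lemma arc_image_disjoint e f : e \in edges G -> f \in edges G -> [disjoint e & f]%B ->
  arc_image e `<=` ~` arc_image f.
Proof.
move=> e_edge f_edge dis p pe pf; have ef : e <> f.
  by have [u ue] := edge_nonempty e_edge => ef; have := disjointFr dis ue; rewrite -ef ue.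
have [[u ue pu]|[s s01 ps]] := arc_imageP e_edge pe.
  by apply: (@arc_image_pos f u f_edge); rewrite ?(disjointFr dis ue) // -pu.
have [[u uf pu]|[t t01 pt]] := arc_imageP f_edge pf.
  by apply: (@arc_image_pos e u e_edge); rewrite ?(disjointFl dis uf) // -pu.
case: emb => _ _ _ _ off_arcs; apply: (off_arcs e f e_edge f_edge ef s t s01 t01).
by rewrite -ps -pt.
Qed.

Lemma arc_images_compact (P : {pred {set G}}) : {subset P <= edges G} ->
  compact (\bigcup_(e in [set` P]) arc_image e).
Proof.
by move=> P_edges; rewrite bigcup_pred; apply: bigsetU_compact => e /P_edges/arc_image_compact.
Qed.

Lemma drawing_compact : compact (drawing pos arc).
Proof.
by apply: compactU; [exact/finite_compact/finite_image/finite_finset | exact: arc_images_compact].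
Qed.

Lemma drawing_arc_image e : e \in edges G -> arc_image e `<=` drawing pos arc.
Proof. by move=> e_edge p pe; right; exists e. Qed.

(* Instead of a ray to infinity: [l] continues [pos v] to a point at which some linear
   functional is larger than on the whole drawing. *)
Lemma exists_escaping_polyline v :
  topology_structure.closure (outer_face (drawing pos arc)) (pos v) ->
  exists (l : seq (R * R)) (al be : R),
    (forall e, e \in edges G -> v \notin e -> trace (pos v) l `<=` ~` arc_image e) /\
    forall p, drawing pos arc p ->
      al * p.1 + be * p.2 < al * (last (pos v) l).1 + be * (last (pos v) l).2.
Proof.
move=> v_outer; pose B := \bigcup_(e in [set e | (e \in edges G) && (v \notin e)]) arc_image e.
have B_compact : compact B by apply: arc_images_compact => e /andP[].
have [|delta delta_gt0 dis] := disjoint_thickenings (@compact_set1 _ (pos v)) B_compact.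
  by move=> _ -> [e /andP[e_edge ve]]; exact: arc_image_pos.
have [p [[Dp p_unbounded] vp]] := v_outer _ (nbhsx_ballx (pos v) delta delta_gt0).
have [M [_ M_bound]] := compact_bounded drawing_compact.
have [x px M_lt_x] := unbounded_far (M + 1) p_unbounded.
have [|l lx l_free] := connected_polygonally_joined _ px.
  exact/closed_openC/(compact_closed (@norm_hausdorff _ _))/drawing_compact.
have [al [be far]] := exists_separating_functional M_lt_x.
exists (p :: l), al, be; split=> [e e_edge ve q|q Dq]; last first.
  by rewrite /= lx; apply: far; apply: M_bound Dq; rewrite ltrDl.
case/trace_cons=> [q_vp|/l_free not_D] qe; last exact/not_D/(drawing_arc_image e_edge).
have /dis[] : thickening [set pos v] delta q.
  exists (pos v) => //; have := segment_ball (ballxx (pos v) delta_gt0) vp q_vp.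
  by rewrite -ball_normE.
by apply: (sub_thickening delta_gt0); exists e; rewrite //= e_edge.
Qed.

Lemma polygon_disjoint (B : set (R * R)) e : compact B -> e \in edges G ->
  arc_image e `<=` ~` B ->
  \forall N \near \oo, trace (arc e 0) (polygon (arc e) N) `<=` ~` B.
Proof.
move=> B_compact e_edge dis.
have [delta delta_gt0 sep] := disjoint_thickenings (arc_image_compact e_edge) B_compact dis.
have := trace_polygon_thickening (arc_continuous e_edge) delta_gt0.
apply: filterS => N near_e p /near_e/sep not_B Bp.
by apply: not_B; exact: sub_thickening Bp.
Qed.

Lemma polygons_disjoint e f : e \in edges G -> f \in edges G -> [disjoint e & f]%B ->
  \forall N \near \oo, trace (arc e 0) (polygon (arc e) N) `<=`
                       ~` trace (arc f 0) (polygon (arc f) N).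
Proof.
move=> e_edge f_edge /(arc_image_disjoint e_edge f_edge) dis.
have [delta delta_gt0 sep] :=
  disjoint_thickenings (arc_image_compact e_edge) (arc_image_compact f_edge) dis.
have near_e := trace_polygon_thickening (arc_continuous e_edge) delta_gt0.
have near_f := trace_polygon_thickening (arc_continuous f_edge) delta_gt0.
by apply: filterS2 near_e near_f => N near_e near_f p /near_e/sep not_f /near_f.
Qed.

Lemma polygon_joins u v N : (0 < N)%N -> adj u v ->
  joins (arc [set u; v]%SET 0) (polygon (arc [set u; v]%SET) N) (pos u) (pos v).
Proof.
move=> N_gt0 uv; set e := [set u; v]%SET; have e_edge : e \in edges G by exact: mem_edges.
case: emb => _ _ /(_ e e_edge) ends _ _.
have pos_neq : pos u <> pos v by move=> /pos_injective uv_eq; rewrite uv_eq adj_irr in uv.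
have : [set arc e 0; arc e 1] (pos u) by rewrite ends; exists u => //=; rewrite !inE eqxx.
have : [set arc e 0; arc e 1] (pos v) by rewrite ends; exists v => //=; rewrite !inE eqxx orbT.
rewrite /joins last_polygon //.
by move=> [] /= v_end [] /= u_end;
  [case: pos_neq; rewrite u_end | right | left | case: pos_neq; rewrite u_end].
Qed.

Lemma all_polygons_disjoint :
  \forall N \near \oo, forall e f, e \in edges G -> f \in edges G -> [disjoint e & f]%B ->
    trace (arc e 0) (polygon (arc e) N) `<=` ~` trace (arc f 0) (polygon (arc f) N).
Proof.
apply: filter_forall => e; apply: filter_forall => f.
have [e_edge|/negP not_edge] := boolP (e \in edges G); last by apply: nearW.
have [f_edge|/negP not_edge] := boolP (f \in edges G); last by apply: nearW.
have [dis|/negP not_dis] := boolP [disjoint e & f]%B; last by apply: nearW.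
by apply: filterS (polygons_disjoint e_edge f_edge dis).
Qed.

Lemma all_polygons_ray_disjoint (ray : G -> seq (R * R)) :
  (forall v e, e \in edges G -> v \notin e -> trace (pos v) (ray v) `<=` ~` arc_image e) ->
  \forall N \near \oo, forall e v, e \in edges G -> v \notin e ->
    trace (arc e 0) (polygon (arc e) N) `<=` ~` trace (pos v) (ray v).
Proof.
move=> dis; apply: filter_forall => e; apply: filter_forall => v.
have [e_edge|/negP not_edge] := boolP (e \in edges G); last by apply: nearW.
have [v_e|/negP not_in] := boolP (v \notin e); last by apply: nearW.
have arc_ray : arc_image e `<=` ~` trace (pos v) (ray v) by move=> p pe p_ray; exact: dis p_ray pe.
by apply: filterS (polygon_disjoint (@trace_compact _ _ (pos v) (ray v)) e_edge arc_ray).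
Qed.

End Drawing.

Theorem outerplanar_even_tournament (R : realType) (G : sgraph) :
  outerplanar G R -> exists t, even_tournament (@adj G) t.
Proof.
move=> [pos [arc [emb outer]]].
have [ray ray_ex] := choice (fun v => exists_escaping_polyline emb (outer v)).
have [al al_ex] := choice ray_ex; have [be escapes] := choice al_ex.
have near_edges := all_polygons_disjoint emb.
have near_rays := all_polygons_ray_disjoint emb (fun v => (escapes v).1).
have [N [[edges_dis rays_dis] N_gt0]] :=
  filter_ex (filterI (filterI near_edges near_rays) (nbhs_infty_gt 0)).
apply: (@polygonal_even_tournament _ _ _ pos (fun u v => arc [set u; v]%SET 0)
  (fun u v => polygon (arc [set u; v]%SET) N) ray al be).
- exact: pos_injective emb.
- by move=> u v; exact: polygon_joins.
- move=> a b c d ab cd dis; apply: edges_dis; rewrite ?mem_edges //.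
  by apply/pred0P => x; have /pred0P/(_ x) := dis; rewrite /= !inE.
- by move=> u w v uw v_uw; apply: rays_dis; rewrite ?mem_edges // !inE in v_uw *.
- move=> v u w p uw /mem_polygon[s s01 ->]; apply: (escapes v).2.
  by apply: (drawing_arc_image pos (mem_edges uw)); exists s.
Qed.

(** * Incidences as arcs *)

Local Close Scope classical_set_scope.
Local Open Scope nat_scope.

Section Incidences.
Variable G : sgraph.
Implicit Types (u v w : G) (i j : incidence G).

Definition along i u v := adj u v && (val i == (u, [set u; v])).

Lemma along_strong i u : (i \in strong u) = [exists v, along i u v].
Proof. by rewrite inE. Qed.

Lemma along_weak i v : (i \in weak v) = [exists u, along i u v].
Proof. by rewrite inE; apply: eq_existsb => u; rewrite /along adj_sym setUC. Qed.

Lemma along_inj i j u v : along i u v -> along j u v -> i = j.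
Proof. by move=> /andP[_ /eqP iE] /andP[_ /eqP jE]; apply: val_inj; rewrite iE. Qed.

Lemma along_fun i u v w : along i u v -> along i u w -> v = w.
Proof.
move=> /andP[uv /eqP iE] /andP[_]; rewrite iE => /eqP[] /setP/(_ v).
have vu : v != u by apply: contraTneq uv => ->; rewrite adj_irr.
by rewrite !inE eqxx orbT (negbTE vu) => /esym/eqP.
Qed.

Lemma exists_along u v : adj u v -> exists i, along i u v.
Proof.
move=> uv; have uv_inc : ([set u; v] \in edges G) && (u \in [set u; v]).
  by rewrite mem_edges // !inE eqxx.
by exists (exist _ (u, [set u; v]) uv_inc); rewrite /along uv eqxx.
Qed.

Lemma along_incidence i : exists v, along i (val i).1 v.
Proof.
have /andP[/imsetP[[a b]]] := valP i; rewrite inE /= => ab iE; rewrite iE !inE /along.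
case/orP=> /eqP uE; [exists b | exists a]; rewrite uE ?[adj b a]adj_sym ab ?[[set b; a]]setUC.
  by rewrite -iE -uE -surjective_pairing eqxx.
by rewrite -iE -uE -surjective_pairing eqxx.
Qed.

Section Colors.
Variables (D : nat) (C : arc_coloring G D) (phi : incidence G -> 'I_D).
Hypotheses (C_coloring : conditional_coloring (@adj G) C).
Hypothesis phiP : forall i u v, along i u v -> C u v (phi i).

Lemma along_color u v k : C u v k -> exists2 i, along i u v & phi i = k.
Proof.
case: C_coloring => [[C_fun _ _ _ _] C_adj _] uv_k.
have [|i i_uv] := @exists_along u v; first by rewrite C_adj; apply/existsP; exists k.
by exists i => //; apply: C_fun (phiP i_uv) uv_k.
Qed.

Lemma strong_color_card u k : #|[set i in strong u | phi i == k]| <= 1.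
Proof.
case: C_coloring => [[_ _ _ C_out _] _ _]; apply/card_le1_eqP => j i.
rewrite 2!inE !along_strong => /andP[/existsP[w jw] /eqP jk] /andP[/existsP[v iv] /eqP ik].
have /C_out uv_out := phiP iv; have := phiP jw; rewrite jk -ik => /uv_out vw.
by rewrite -vw in jw; exact: along_inj iv jw.
Qed.

Lemma weak_color_card u k : #|[set i in weak u | phi i == k]| <= 1.
Proof.
case: C_coloring => [[_ _ _ _ C_in] _ _]; apply/card_le1_eqP => j i.
rewrite 2!inE !along_weak => /andP[/existsP[w jw] /eqP jk] /andP[/existsP[v iv] /eqP ik].
have /C_in vu_in := phiP iv; have := phiP jw; rewrite jk -ik => /vu_in vw.
by rewrite -vw in jw; exact: along_inj iv jw.
Qed.

Lemma color_covered u k : D - 1 <= degree u ->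
  exists2 i, i \in weak u :|: strong u & phi i = k.
Proof.
case: C_coloring => C_proper C_adj C_sat deg_u.
have disj : [disjoint free_out C u & free_in C u].
  apply: (implyP (C_sat u)).
  by rewrite (card_free_out u C_proper C_adj) leq_subLR addnC -leq_subLR.
have /nandP[] : ~~ ((k \in free_out C u) && (k \in free_in C u)).
  by apply/negP => /andP[k_out]; rewrite (disjointFr disj k_out).
  rewrite inE => /forallPn[v]; rewrite negbK => /along_color[i i_uv <-]; exists i => //.
  by rewrite inE along_strong; apply/orP; right; apply/existsP; exists v.
rewrite inE => /forallPn[v]; rewrite negbK => /along_color[i i_vu <-]; exists i => //.
by rewrite inE along_weak; apply/orP; left; apply/existsP; exists v.
Qed.

Lemma arc_coloring_incidence : conditional_incidence_coloring phi.
Proof.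
split; [|exact: weak_color_card | exact: strong_color_card|].
  move=> u v i j uv iE jE phi_ij; case: C_coloring => [[_ _ C_neq _ _] _ _].
  have /phiP uv_i : along i u v by rewrite /along uv iE eqxx.
  have /phiP vu_j : along j v u by rewrite /along adj_sym uv jE setUC eqxx.
  by have := C_neq _ _ _ uv_i; rewrite phi_ij vu_j.
by move=> u deg_u k; exact: color_covered.
Qed.

End Colors.

Lemma colorable_incidence D : colorable D (@adj G) ->
  exists phi : incidence G -> 'I_D, conditional_incidence_coloring phi.
Proof.
case=> C C_coloring; have [_ C_adj _] := C_coloring.
have incidence_color i : exists k, forall u v, along i u v -> C u v k.
  have [v iv] := along_incidence i; have := iv => /andP[uv _].
  have /existsP[k Ck] : [exists k, C (val i).1 v k] by rewrite -C_adj.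
  exists k => u w iw; have uE : u = (val i).1 by case/andP: iw => _ /eqP ->.
  by rewrite uE in iw *; rewrite -(along_fun iv iw).
have [phi phiP] := choice incidence_color.
by exists phi; exact: arc_coloring_incidence phiP.
Qed.

End Incidences.

Theorem theorem6 (R : realType) (Delta : nat) (hDelta : (4 <= Delta)%N)
    (G : sgraph) (hG : outerplanar G R) (hdeg : (max_degree G <= Delta)%N) :
  exists phi : incidence G -> 'I_Delta, conditional_incidence_coloring phi.
Proof.
have [t G_t] := outerplanar_even_tournament hG.
apply: colorable_incidence.
apply: even_tournament_colorable hDelta (@adj_sym G) (@adj_irr G) G_t _ => u.
exact: leq_trans (leq_bigmax u) hdeg.
Qed.
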